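(* Let $n\in\mathbb N$, let $X=\mathbb R^n$ or $X=[0,\infty)^n$, and let $d$ be the usual metric on $X$. Then $\operatorname{ind}(u_dX\setminus X)=\operatorname{Ind}(u_dX\setminus X)=\dim(u_dX\setminus X)=n$.
   Context: $\mathbb N=\{1,2,\dots\}$. Compactifications are Hausdorff. For a metric space $(X,d)$, let $U_d^*(X)$ be the set of all bounded uniformly continuous functions $X\to\mathbb R$. The Smirnov compactification $u_dX$ of $(X,d)$ is the compactification of $X$ associated with the closed subring $U_d^*(X)$ of $C^*(X)$ (the Banach algebra of bounded continuous real-valued functions with the sup-norm); concretely, it is the closure of $e(X)$ in $\prod_{f\in U_d^*(X)}[\inf f(X),\sup f(X)]$, where $e(x)=(f(x))_{f}$ is the evaluation map, and $X$ is identified with $e(X)$. $\dim$ is the covering dimension, $\operatorname{ind}$ the small inductive dimension and $\operatorname{Ind}$ the large inductive dimension. For a normal space $Y$: $\operatorname{Ind}Y=-1$ iff $Y=\emptyset$; for $n\ge 0$, $\operatorname{Ind}Y\le n$ iff for every pair $A,B$ of disjoint closed subsets of $Y$ there is a partition $L$ between $A$ and $B$ (a closed set $L\subset Y$ for which there are disjoint open sets $U\supset A$, $V\supset B$ with $Y\setminus L=U\cup V$) such that $\operatorname{Ind}L\le n-1$. $\operatorname{ind}$ is defined in the same way with $A$ restricted to be a single point. *)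

(* Defs.v *)
From HB Require Import structures.
From mathcomp Require Import all_boot all_order all_algebra.
From mathcomp Require Import all_classical all_reals all_analysis.
From mathcomp Require Import ring lra.

Set Implicit Arguments.
Unset Strict Implicit.
Unset Printing Implicit Defensive.

Import Order.TTheory GRing.Theory Num.Theory.
Import numFieldNormedType.Exports.

Local Open Scope classical_set_scope.
Local Open Scope ring_scope.
Local Open Scope card_scope.

(* The library's metric on 'rV[R]_n comes from the sup norm, so the Euclidean
   metric is put on an alias. *)
Definition euclid (R : realType) (n : nat) : Type := 'rV[R]_n.

Section euclid_metric.
Context (R : realType) (n : nat).
Implicit Types x y z : euclid R n.

HB.instance Definition _ := Choice.copy (euclid R n) 'rV[R]_n.

Definition euclid_coord x (i : 'I_n) : R := (x : 'rV[R]_n) ord0 i.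

Definition euclid_dist x y : R :=
  Num.sqrt (\sum_(i < n) (euclid_coord x i - euclid_coord y i) ^+ 2).

Lemma euclid_distxx x : euclid_dist x x = 0.
Proof. by rewrite /euclid_dist big1 ?sqrtr0// => i _; rewrite subrr expr0n. Qed.

Lemma euclid_dist_positivity x y : euclid_dist x y = 0 -> x = y.
Proof.
move/eqP; rewrite sqrtr_eq0 => le0.
have /eqP : \sum_(i < n) (euclid_coord x i - euclid_coord y i) ^+ 2 == 0.
  by rewrite eq_le le0 sumr_ge0// => i _; exact: sqr_ge0.
move/psumr_eq0P => xy; apply/rowP => i; apply/eqP; rewrite -subr_eq0 -sqrf_eq0.
by apply/eqP; apply: xy => // j _; exact: sqr_ge0.
Qed.

Lemma euclid_dist_sym x y : euclid_dist x y = euclid_dist y x.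
Proof. by congr Num.sqrt; apply: eq_bigr => i _; rewrite -opprB sqrrN. Qed.

Lemma sum_CauchySchwarz (a b : 'I_n -> R) :
  (\sum_i a i * b i) ^+ 2 <= (\sum_i a i ^+ 2) * (\sum_i b i ^+ 2).
Proof.
set A := \sum_i a i ^+ 2; set B := \sum_i b i ^+ 2; set S := \sum_i a i * b i.
have A0 : 0 <= A by apply: sumr_ge0 => i _; exact: sqr_ge0.
have quad t : 0 <= A * t ^+ 2 + 2 * S * t + B.
  have -> : A * t ^+ 2 + 2 * S * t + B = \sum_i (a i * t + b i) ^+ 2.
    rewrite /A /S /B !(mulr_suml, mulr_sumr) -!big_split/=.
    by apply: eq_bigr => i _; ring.
  by apply: sumr_ge0 => i _; exact: sqr_ge0.
have [A00|An0] := eqVneq A 0.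
  have Si : S = 0.
    rewrite /S big1// => i _; move/psumr_eq0P : A00 => /(_ _ i isT)/eqP.
    by rewrite sqrf_eq0 => /(_ (fun i _ => sqr_ge0 _))/eqP ->; rewrite mul0r.
  by rewrite Si expr0n mulr_ge0//; apply: sumr_ge0 => i _; exact: sqr_ge0.
have Ap : 0 < A by rewrite lt_neqAle eq_sym An0.
have := mulr_ge0 A0 (quad (- S / A)).
suff -> : A * (A * (- S / A) ^+ 2 + 2 * S * (- S / A) + B) = A * B - S ^+ 2.
  by rewrite subr_ge0.
by field.
Qed.

Lemma euclid_dist_triangle y x z :
  euclid_dist x z <= euclid_dist x y + euclid_dist y z.
Proof.
pose a i := euclid_coord x i - euclid_coord y i.
pose b i := euclid_coord y i - euclid_coord z i.
rewrite -(@ler_pXn2r _ 2) ?nnegrE ?addr_ge0 ?sqrtr_ge0//.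
rewrite sqrrD !sqr_sqrtr ?sumr_ge0// => [|i _|i _|i _]; try exact: sqr_ge0.
have -> : \sum_i (euclid_coord x i - euclid_coord z i) ^+ 2 =
    \sum_i a i ^+ 2 + (\sum_i a i * b i) *+ 2 + \sum_i b i ^+ 2.
  rewrite -sumrMnl -!big_split/=; apply: eq_bigr => i _.
  by rewrite /a /b; ring.
rewrite lerD2r lerD2l lerMn2r/=.
rewrite -sqrtrM ?sumr_ge0// => [|i _]; last exact: sqr_ge0.
rewrite (le_trans (ler_norm _))// -sqrtr_sqr ler_wsqrtr//.
exact: sum_CauchySchwarz.
Qed.

HB.instance Definition _ := isMetric.Build R (euclid R n)
  euclid_distxx euclid_dist_positivity euclid_dist_sym euclid_dist_triangle.

End euclid_metric.

Section sub_metric.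
Context (R : realType) (X : metricType R) (A : set X).
Implicit Types x y : A.

Definition sub_mdist x y : R := mdist (set_val x) (set_val y).

Lemma sub_mdist_ge0 x y : 0 <= sub_mdist x y.
Proof. exact: mdist_ge0. Qed.

Lemma sub_mdist_positivity x y : sub_mdist x y = 0 -> x = y.
Proof. by move/mdist_positivity/val_inj. Qed.

Lemma sub_ballEmdist x d : ball x d = [set y | sub_mdist x y < d].
Proof.
by rewrite /ball/= /initial_ball/= ballEmdist.
Qed.

HB.instance Definition _ := PseudoMetric_isMetric.Build R (set_type A)
  sub_mdist_ge0 sub_mdist_positivity sub_ballEmdist.

End sub_metric.

Definition orthant (R : realType) (n : nat) : set (euclid R n) :=
  [set x | forall i, 0 <= euclid_coord x i].

Arguments orthant : clear implicits.

Section smirnov.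
Context (R : realType) (X : metricType R).

(* U_d^*(X): bounded, uniformly continuous. *)
Definition ucb : set (X -> R) :=
  [set f | bounded_fun f /\ unif_continuous f].

Definition smirnov_interval (f : ucb) : set R :=
  `[inf (range (set_val f)), sup (range (set_val f))].

Definition smirnov_cube : topologicalType :=
  prod_topology (fun f : ucb => set_type (smirnov_interval f)).

Lemma smirnov_eval_subproof (x : X) (f : ucb) :
  set_val f x \in smirnov_interval f.
Proof.
have [[M [_ bf]] _] : ucb (set_val f) by exact: set_valP.
have {}bf y : `|set_val f y| <= M + 1 by apply: bf => //; rewrite ltrDl.
rewrite inE /smirnov_interval/= in_itv/=; apply/andP; split.
- apply: ge_inf; last by exists x.
  by exists (- (M + 1)) => _ [y _ <-]; have /ler_normlP[]:= bf y; lra.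
- apply: ub_le_sup; last by exists x.
  by exists (M + 1) => _ [y _ <-]; have /ler_normlP[]:= bf y.
Qed.

Definition smirnov_eval (x : X) : smirnov_cube :=
  fun f => exist _ (set_val f x) (smirnov_eval_subproof x f).

Definition smirnov : set smirnov_cube := closure (range smirnov_eval).

Definition smirnov_remainder : topologicalType :=
  set_type (smirnov `\` range smirnov_eval).

End smirnov.

Arguments smirnov_remainder {R} X.

Section dimensions.
Implicit Types Y : topologicalType.

Definition partition_between Y (L A B : set Y) : Prop :=
  closed L /\ exists U V : set Y,
    [/\ open U /\ A `<=` U, open V /\ B `<=` V, U `&` V = set0 &
        ~` L = U `|` V].

(* The three predicates below read "dimension <= k - 1", so that k = 0 is the
   case of dimension -1. Ind_lt and dim_lt use the definitions standard for
   normal spaces; smirnov_remainder X is compact Hausdorff for X locally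
   compact. *)
Fixpoint ind_lt (k : nat) Y : Prop :=
  if k is k'.+1 then
    forall (x : Y) (B : set Y), closed B -> ~ B x ->
      exists2 L : set Y, partition_between L [set x] B & ind_lt k' (set_type L)
  else [set: Y] = set0.

Fixpoint Ind_lt (k : nat) Y : Prop :=
  if k is k'.+1 then
    forall A B : set Y, closed A -> closed B -> A `&` B = set0 ->
      exists2 L : set Y, partition_between L A B & Ind_lt k' (set_type L)
  else [set: Y] = set0.

Definition finite_open_cover Y (C : set (set Y)) : Prop :=
  [/\ finite_set C, C `<=` open & \bigcup_(W in C) W = setT].

Definition refines Y (D C : set (set Y)) : Prop :=
  forall W, D W -> exists2 V, C V & W `<=` V.

(* Order <= k - 1 of the refinement: no point lies in more than k members. *)
Definition dim_lt (k : nat) Y : Prop :=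
  forall C : set (set Y), finite_open_cover C ->
    exists D : set (set Y), [/\ finite_open_cover D, refines D C &
      forall y, D `&` [set W | W y] #<= `I_k].

Definition ind_eq Y (n : nat) : Prop := ind_lt n.+1 Y /\ ~ ind_lt n Y.
Definition Ind_eq Y (n : nat) : Prop := Ind_lt n.+1 Y /\ ~ Ind_lt n Y.
Definition dim_eq Y (n : nat) : Prop := dim_lt n.+1 Y /\ ~ dim_lt n Y.

End dimensions.

(* Main.v *)
Require Import Defs.
From mathcomp Require Import all_boot all_order all_algebra all_fingroup.
From mathcomp Require Import all_classical all_reals all_analysis.
From mathcomp Require Import ring lra zify.

(** Let Y be the remainder of the compactification. The equalities come from the
    chain n <= dim Y <= ind Y <= Ind Y <= n, the two middle inequalities being
    valid in every compact Hausdorff space.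

    A continuous function on X extends to the compactification exactly when it
    is bounded and uniformly continuous, so closures of subsets of X are
    disjoint when the subsets are at positive distance
    (closure_smirnov_disjoint), and disjoint compact sets have neighbourhoods
    whose traces on X are at positive distance (smirnov_far_compact). Bounded
    subsets of X acquire no new limit points, so Y is closed, hence compact.

    Upper bound. Let T be the set of points added in the closure of the
    (k-1)-dimensional skeleton P of a cubical grid in X; the whole of Y is the
    case k = n + 1. Disjoint closed sets A, B of T are far apart on X. Cut P into
    the half-open cells of a fine subdivision of the grid, and let U be the union
    of the cells that meet a neighbourhood of A, and V that of the others. The
    intersection of the closures of U and V is a partition between A and B. Close
    points of P in different cells are close to the skeleton of the next lower
    dimension of the subdivision (skeleton_crossing), so the partition consists
    of points added to that skeleton, and Ind T <= k - 1 follows by induction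
    (Ind_lt_ends_skeleton).

    The inequality dim <= ind. Points of Y have small neighbourhoods whose
    boundaries lie in closed sets of smaller dimension. By compactness, Y is the
    union of finitely many disjoint small open sets and of a closed set F which
    is a finite union of such sets. The finite sum theorem for dim bounds the
    dimension of F, and a cover of F is extended to open sets of Y without
    raising its order (ind_lt_cov_dim_lt).

    Lower bound. Take copies of the cube in X, with even integer translations
    going to infinity; a cluster point of their embeddings maps the points of a
    fine grid of the cube into Y, neighbouring grid points having close images.
    Opposite faces of the cube stay at positive distance, so Y has a finite open
    cover none of whose members meets the limits of two opposite faces. Suppose
    that a refinement has order at most n, and choose for each grid point a member
    of it that contains the image of the point and of all its neighbours. Along an
    edge path with one step in each coordinate direction the members at the n + 1
    vertices share a point, so two of them coincide. This is contradicted by a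
    degree argument (exists_distinct_labels): to a member attach the 0-1 vector of
    the faces it avoids; then the determinants of the differences of these
    vectors along the edges of all such paths sum, after folding a discrete torus
    onto the grid, to a number which depends only on the boundary behaviour and is
    not zero (exists_det_neq0), while a repeated member makes the determinant
    vanish. *)

Set Implicit Arguments.
Unset Strict Implicit.
Unset Printing Implicit Defensive.

Import Order.TTheory GRing.Theory Num.Theory.
Import numFieldNormedType.Exports.

Local Open Scope classical_set_scope.
Local Open Scope ring_scope.

(** * Discrete differential forms on a finite torus *)

Section Degree.
Context (R : realDomainType) (T : finZmodType) (n : nat) (e : 'I_n -> T).
Implicit Types (th : 'I_n -> T -> 'I_n -> R) (s : 'S_n) (p q j : 'I_n).

(** Displacement from the starting point, before the j-th step, of the path that
    makes one step in each direction, in the order given by s. *)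
Definition path_offset s j : T := \sum_(l < n | (l < j)%N) e (s l).

(** Integral over the torus of the wedge product of the 1-forms th 0, .., th (n-1):
    a form assigns a value to each edge, given by its origin and its direction, and
    the integral is a signed sum over all edge paths with one step per
    direction. *)
Definition wedge_sum th : R := \sum_(s : 'S_n) (-1) ^+ s *
  \sum_(x : T) \prod_(j < n) th j (x + path_offset s j) (s j).

Definition closed_form (f : T -> 'I_n -> R) :=
  forall x i k, f x i + f (x + e i) k = f x k + f (x + e k) i.

Definition const_form (f : T -> 'I_n -> R) := forall x y i, f x i = f y i.

Definition exact_form (b : T -> R) : T -> 'I_n -> R :=
  fun x i => b (x + e i) - b x.

(* Displacement due to the steps strictly between p and j. *)
Let gap s p j : T := \sum_(l < n | (p < l < j)%N) e (s l).

(* Product of the values of the forms of index j > p along the path that starts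
   at z with step p + 1, the step p being inserted right after step k. *)
Let skip th p s (k : nat) (z : T) : R :=
  \prod_(j < n | (p < j)%N)
    th j (z + gap s p j + (if (k < j)%N then e (s p) else 0)) (s j).

Let path_offsetE s p j : (p < j)%N ->
  path_offset s j = path_offset s p + e (s p) + gap s p j.
Proof.
move=> pj; rewrite /path_offset (bigID (fun l : 'I_n => (l < p)%N))/=.
rewrite -addrA; congr (_ + _); first by apply: eq_bigl => l; lia.
rewrite (bigD1 p)/=; last by rewrite pj -leqNgt leqnn.
congr (_ + _); apply: eq_bigl => l; rewrite -leqNgt -val_eqE/=; lia.
Qed.

Let tpermp s p q : (tperm p q * s)%g p = s q.
Proof. by rewrite permM tpermL. Qed.

Let tpermq s p q : (tperm p q * s)%g q = s p.
Proof. by rewrite permM tpermR. Qed.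

Let tpermx s p q j : j != p -> j != q -> (tperm p q * s)%g j = s j.
Proof. by move=> jp jq; rewrite permM tpermD// eq_sym. Qed.

Let gap_tperm s p q j : (p < q)%N -> (j <= q)%N ->
  gap (tperm p q * s)%g p j = gap s p j.
Proof.
move=> pq jq; apply: eq_bigr => l /andP[pl lj].
by rewrite tpermx// -val_eqE/=; apply/eqP; lia.
Qed.

Let gap_tperm2 s p q j : (p < q)%N -> (q < j)%N ->
  gap (tperm p q * s)%g p j + e ((tperm p q * s)%g p) = gap s p j + e (s p).
Proof.
move=> pq qj; rewrite /gap (bigD1 q) ?pq ?qj//= [in RHS](bigD1 q) ?pq ?qj//=.
rewrite tpermp tpermq addrAC [RHS]addrAC [e (s p) + _]addrC.
congr (_ + _); apply: eq_bigr => l /andP[/andP[pl lj] lq].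
by rewrite tpermx// -val_eqE/=; apply/eqP; lia.
Qed.

Let skip_diff th s p q z : (p < q)%N ->
  skip th p s q z - skip th p s q.-1 z =
   (th q (z + gap s p q) (s q) - th q (z + gap s p q + e (s p)) (s q)) *
   \prod_(j < n | (p < j)%N && (j != q))
    th j (z + gap s p j + (if (q < j)%N then e (s p) else 0)) (s j).
Proof.
move=> pq; rewrite /skip (bigD1 q)//= [X in _ - X](bigD1 q)//=.
rewrite ltnn addr0 ltn_predL (leq_ltn_trans _ pq)// mulrBl; congr (_ * _ - _ * _).
apply: eq_bigr => j /andP[pj jq]; congr (th j (_ + _) _).
suff -> : (q.-1 < j)%N = (q < j)%N by [].
by move: jq; rewrite -val_eqE/=; lia.
Qed.

(* Exchanging the directions of steps p and q leaves the increment unchanged,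
   because the form of index q is closed; the two terms cancel in a signed sum. *)
Let skip_diff_tperm th s p q z : (p < q)%N -> closed_form (th q) ->
  skip th p (tperm p q * s)%g q z - skip th p (tperm p q * s)%g q.-1 z =
  skip th p s q z - skip th p s q.-1 z.
Proof.
move=> pq thC; rewrite !skip_diff//; congr (_ * _).
  rewrite gap_tperm// tpermp tpermq.
  by have := thC (z + gap s p q) (s p) (s q); lra.
apply: eq_bigr => j /andP[pj jq].
have jp : j != p by rewrite -val_eqE/=; lia.
rewrite (tpermx s jp jq); congr (th j _ _); have [qj|jlq] := ltnP q j.
  by rewrite -!addrA gap_tperm2.
by rewrite gap_tperm.
Qed.

Let skip_sum_step th p (pre : 'S_n -> R) k z :
    (p <= k)%N -> (forall j, (p < j)%N -> closed_form (th j)) ->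
    (forall s q, (p < q)%N -> pre (tperm p q * s)%g = pre s) ->
  \sum_(s : 'S_n) (-1) ^+ s * (pre s * skip th p s k.+1 z) =
  \sum_(s : 'S_n) (-1) ^+ s * (pre s * skip th p s k z).
Proof.
move=> pk thC preE; have [kn|nk] := ltnP k.+1 n; last first.
  apply: eq_bigr => s _; congr (_ * (_ * _)); apply: eq_bigr => j pj.
  by rewrite !ifF//; apply/negbTE; have := ltn_ord j; lia.
pose q := Ordinal kn; have pq : (p < q)%N by rewrite /= ltnS.
apply/eqP; rewrite -subr_eq0 -sumrB -eqNr eq_sym; apply/eqP.
rewrite [in RHS](reindex_inj (mulgI (tperm p q)))/= -sumrN.
apply: eq_bigr => s _; rewrite odd_permM odd_tperm -val_eqE/= (ltn_eqF pq)/=.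
rewrite ?addTb signrN preE// !mulNr opprB opprK [RHS]addrC -!mulrBr.
congr (_ * (_ * _)); rewrite -[k]/((q : nat).-1) skip_diff_tperm//.
exact: thC.
Qed.

(* The signed sum does not depend on where the step p is inserted: moving it past
   step k + 1 is a closedness relation. *)
Let skip_sum th p (pre : 'S_n -> R) z :
    (forall j, (p < j)%N -> closed_form (th j)) ->
    (forall s q, (p < q)%N -> pre (tperm p q * s)%g = pre s) ->
  \sum_(s : 'S_n) (-1) ^+ s * (pre s * skip th p s n z) =
  \sum_(s : 'S_n) (-1) ^+ s * (pre s * skip th p s p z).
Proof.
move=> thC preE.
suff H d : \sum_(s : 'S_n) (-1) ^+ s * (pre s * skip th p s (p + d) z) =
    \sum_(s : 'S_n) (-1) ^+ s * (pre s * skip th p s p z).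
  by rewrite -(H (n - p)%N); under [RHS]eq_bigr do rewrite subnKC 1?ltnW//.
elim: d => [|d IH]; first by rewrite addn0.
by rewrite addnS skip_sum_step ?leq_addr.
Qed.

(** Stokes' theorem. Summation by parts moves the difference from b to the
    remaining forms, which are closed; the forms before p being constant, they do
    not see the translation. *)
Lemma wedge_sum_exact th p b :
    (forall j, (j < p)%N -> const_form (th j)) ->
    (forall j, (p < j)%N -> closed_form (th j)) ->
  th p = exact_form b -> wedge_sum th = 0.
Proof.
move=> thK thC thp.
pose pre s : R := \prod_(j < n | (j < p)%N) th j 0 (s j).
have preE s q : (p < q)%N -> pre (tperm p q * s)%g = pre s.
  move=> pq; apply: eq_bigr => j jp.
  by rewrite tpermx// -val_eqE/=; apply/eqP; lia.
have E s : \sum_(x : T) \prod_(j < n) th j (x + path_offset s j) (s j) =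
    \sum_(z : T) b z * (pre s * skip th p s n z - pre s * skip th p s p z).
  under [RHS]eq_bigr do rewrite mulrBr; rewrite sumrB.
  rewrite [X in _ = X - _](reindex_inj (addIr (path_offset s p + e (s p))))/=.
  rewrite [X in _ = _ - X](reindex_inj (addIr (path_offset s p)))/= -sumrB.
  apply: eq_bigr => x _; rewrite (bigD1 p)//= thp.
  rewrite (bigID (fun j : 'I_n => (j < p)%N))/=.
  have -> : \prod_(i < n | (i != p) && (i < p)%N) th i (x + path_offset s i) (s i)
      = pre s.
    apply: eq_big => [j|j /andP[_ jp]]; last exact: thK.
    by rewrite -val_eqE/=; lia.
  rewrite /exact_form mulrBl; congr (_ * (_ * _) - _ * (_ * _)).
  - by rewrite addrA.
  - apply: eq_big => [j|j]; first by rewrite -val_eqE/=; lia.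
    rewrite -val_eqE/= => jp; rewrite (path_offsetE s (_ : (p < j)%N)); last lia.
    by rewrite ifF ?addr0 ?addrA//; have := ltn_ord j; lia.
  - apply: eq_big => [j|j]; first by rewrite -val_eqE/=; lia.
    rewrite -val_eqE/= => jp; rewrite (path_offsetE s (_ : (p < j)%N)); last lia.
    rewrite ifT; last lia.
    by rewrite -!addrA; congr (th j (_ + (_ + _)) _); rewrite addrC.
rewrite /wedge_sum; under eq_bigr do rewrite E mulr_sumr.
rewrite exchange_big/= big1// => z _.
under eq_bigr do rewrite mulrCA mulrBr.
by rewrite -mulr_sumr sumrB skip_sum// subrr mulr0.
Qed.

Lemma wedge_sum_const (kap : 'I_n -> 'I_n -> R) :
  wedge_sum (fun j _ i => kap j i) = #|T|%:R * \det (\matrix_(j, i) kap j i).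
Proof.
rewrite /wedge_sum mulr_sumr; apply: eq_bigr => s _.
rewrite sumr_const mulrnAr -mulr_natl; congr (_ * (_ * _)).
by apply: eq_bigr => j _; rewrite mxE.
Qed.

(** The integral only depends on the cohomology classes of the factors. *)
Lemma wedge_sum_cohomologous (kap : 'I_n -> 'I_n -> R) (b : 'I_n -> T -> R) :
  wedge_sum (fun j x i => kap j i + exact_form (b j) x i) =
  #|T|%:R * \det (\matrix_(j, i) kap j i).
Proof.
pose th (k : nat) : 'I_n -> T -> 'I_n -> R :=
  fun j x i => kap j i + (if (j < k)%N then 0 else exact_form (b j) x i).
have thS k : (k < n)%N -> wedge_sum (th k) = wedge_sum (th k.+1).
  move=> kn; pose p := Ordinal kn.
  (* The two integrals differ by that of th', whose factor of index k is exact. *)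
  pose th' j := if j == p then exact_form (b p) else th k j.
  apply/eqP; rewrite -subr_eq0 -(@wedge_sum_exact th' p (b p)).
  - rewrite /wedge_sum -sumrB; apply/eqP; apply: eq_bigr => s _.
    rewrite -mulrBr -sumrB; congr (_ * _); apply: eq_bigr => x _.
    rewrite (bigD1 p)//= [X in _ - X](bigD1 p)//= [RHS](bigD1 p)//=.
    rewrite {1 3}/th {1}/th' eqxx ltnn ltnS leqnn addr0.
    rewrite (eq_bigr (fun j => th' j (x + path_offset s j) (s j))); last first.
      by move=> j /negbTE jp; rewrite /th' jp.
    rewrite [X in _ - _ * X](eq_bigr (fun j => th' j (x + path_offset s j) (s j))).
      by rewrite -mulrBl addrC addKr.
    move=> j jp; rewrite /th' (negbTE jp) /th.
    suff -> : (j < k.+1)%N = (j < k)%N by [].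
    by move: jp; rewrite -val_eqE/=; lia.
  - move=> j jp x y i; rewrite /th' ifF; last by apply/negbTE; rewrite neq_ltn jp.
    by rewrite /th jp.
  - move=> j pj x i l.
    rewrite /th' ifF; last by apply/negbTE; rewrite neq_ltn pj orbT.
    have jk : (j < k)%N = false by apply/negbTE; rewrite -leqNgt ltnW.
    rewrite /th jk.
    by rewrite /exact_form (addrAC x (e i)); ring.
  - by rewrite /th' eqxx.
have th_le k : (k <= n)%N -> wedge_sum (th 0%N) = wedge_sum (th k).
  elim: k => [_|k IH kn]; first exact: erefl.
  by rewrite (IH (ltnW kn)); exact: thS.
have -> : wedge_sum (fun j x i => kap j i + exact_form (b j) x i) =
   wedge_sum (th 0%N) by exact: erefl.
rewrite (th_le n (leqnn n)) -wedge_sum_const; apply: eq_bigr => s _.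
congr (_ * _); apply: eq_bigr => x _; apply: eq_bigr => j _.
by rewrite /th ltn_ord addr0.
Qed.

(** The determinants sum to n! times the number of points of the torus: each term
    of their expansion contributes the integral of a permuted wedge product. *)
Lemma exists_det_neq0 (b : 'I_n -> T -> R) : exists (x : T) (s : 'S_n),
  \det (\matrix_(j, i) ((i == s j)%:R +
     exact_form (b i) (x + path_offset s j) (s j))) != 0.
Proof.
apply: contrapT => /forallNP H.
have {}H x s : \det (\matrix_(j, i) ((i == s j)%:R +
    exact_form (b i) (x + path_offset s j) (s j))) = 0.
  by have /forallNP/(_ s)/negP/negPn/eqP := H x.
pose th i : T -> 'I_n -> R := fun x k => (i == k)%:R + exact_form (b i) x k.
have W s : wedge_sum (th \o s) = #|T|%:R * (-1) ^+ s.
  rewrite (@wedge_sum_cohomologous (fun j i => (s j == i)%:R) (b \o s)).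
  by rewrite -det_perm; congr (_ * \det _); apply/matrixP => j i; rewrite !mxE.
have : \sum_(s : 'S_n) (-1) ^+ s * wedge_sum (th \o s) = (n`! * #|T|)%:R.
  under eq_bigr do rewrite W mulrCA -expr2 sqrr_sign mulr1.
  by rewrite sumr_const card_Sn natrM mulr_natl.
rewrite /wedge_sum; under eq_bigr do rewrite mulr_sumr.
rewrite exchange_big/= big1 => [/esym/eqP|t _].
  rewrite pnatr_eq0 muln_eq0 -leqn0 leqNgt fact_gt0/=.
  by apply/negP; rewrite -lt0n; apply/card_gt0P; exists 0.
under eq_bigr do rewrite mulrCA mulr_sumr.
rewrite -mulr_sumr exchange_big/= big1 ?mulr0// => x _.
rewrite -[RHS](H x t); apply: eq_bigr => s _; congr (_ * _).
by apply: eq_bigr => j _; rewrite mxE.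
Qed.

End Degree.

(** * Induction over compact sets and subspaces *)

Section CompactInduction.
Context (Y : topologicalType).

(** A property of sets that passes to subsets and to finite unions and holds
    locally on a compact set holds for that set. *)
Lemma compact_ind (A : set Y) (P : set Y -> Prop) :
    compact A -> P set0 ->
    (forall S S', S `<=` S' -> P S' -> P S) ->
    (forall S S', P S -> P S' -> P (S `|` S')) ->
    (forall x, A x -> exists2 N, nbhs x N & P N) -> P A.
Proof.
move=> cA P0 PS PU Ploc; apply: contrapT => nPA.
pose F := filter_from P (fun S => A `\` S).
have FF : ProperFilter F.
  apply: filter_from_proper; last first.
    move=> S PS'; apply/set0P/eqP; rewrite setD_eq0 => AS.
    exact: nPA (PS _ _ AS PS').
  apply: filter_from_filter; first by exists set0.
  move=> S S' PS1 PS2; exists (S `|` S'); first exact: PU.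
  by move=> x [Ax /not_orP[]].
have FA : F A by exists set0 => // x [].
have [x [Ax /(_ (A `\` _))clx]] := cA F FF FA.
have [N Nx PN] := Ploc x Ax.
have [y [[_ nN] Ny]] := clx N N (ex_intro2 _ _ N PN (fun _ => id)) Nx.
exact: nN.
Qed.

End CompactInduction.

Section SetType.
Context (Y : topologicalType) (S : set Y).

Lemma open_set_typeP (U : set (set_type S)) :
  open U -> exists2 V : set Y, open V & U = set_val @^-1` V.
Proof. by case=> V oV <-; exists V. Qed.

Lemma continuous_set_val : continuous (set_val : set_type S -> Y).
Proof. exact: initial_continuous. Qed.

Lemma open_set_val (V : set Y) :
  open V -> open (set_val @^-1` V : set (set_type S)).
Proof. by move=> oV; exists V. Qed.

Lemma closed_set_val (V : set Y) :
  closed V -> closed (set_val @^-1` V : set (set_type S)).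
Proof. by move=> ?; apply: preimage_closed => // x _; exact: continuous_set_val. Qed.

Lemma compact_set_type : compact S -> compact [set: set_type S].
Proof.
move=> cS F FF _.
have [x [Sx clx]] := cS (set_val @ F) _ (filterS (fun y _ => set_valP y) filterT).
exists (exist _ x (mem_set Sx)); split=> // A B FA.
rewrite nbhsE => -[_ [[V oV <-] Vx] VB].
have [y [[z Az <-] Vz]] := clx (set_val @` A) V
  (filterS (fun y Ay => ex_intro2 _ _ y Ay erefl) FA) (open_nbhs_nbhs (conj oV Vx)).
by exists z; split => //; apply: VB.
Qed.

Lemma hausdorff_set_type : hausdorff_space Y -> hausdorff_space (set_type S).
Proof.
move=> hY x y clxy; apply/val_inj/hY => A B xA yB.
have [z [Az Bz]] := clxy _ _ (continuous_set_val xA) (continuous_set_val yB).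
by exists (set_val z).
Qed.

End SetType.

(** * Covering dimension and inductive dimensions *)

Section Order.
Local Open Scope nat_scope.
Context (Y : Type).

(** The members of a finite family, counted with their indices, overlap at
    most k-fold over the points of S. *)
Definition order_le k m (V : 'I_m -> set Y) (S : set Y) :=
  forall y, S y -> \sum_(i < m) `[< V i y >] <= k.

Lemma leq_count m (P Q : 'I_m -> Prop) : (forall i, P i -> Q i) ->
  \sum_(i < m) `[< P i >] <= \sum_(i < m) `[< Q i >].
Proof.
move=> PQ; apply: leq_sum => i _; case: asboolP => // Pi.
by rewrite lt0b; apply/asboolP/PQ.
Qed.

End Order.

(** Dimension at most k - 1 of the subset S of Y, expressed with sets open in Y:
    finite open families covering S have open shrinkings that cover S with order
    at most k on S. *)
Definition cov_dim_lt (k : nat) (Y : topologicalType) (S : set Y) :=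
  forall m (U : 'I_m -> set Y), (forall i, open (U i)) ->
    S `<=` \bigcup_i U i ->
  exists V : 'I_m -> set Y, [/\ forall i, open (V i), forall i, V i `<=` U i,
    S `<=` \bigcup_i V i & order_le k V S].

Lemma open_setD (Y : topologicalType) (A B : set Y) :
  open A -> closed B -> open (A `\` B).
Proof. by move=> oA cB; rewrite setDE; apply: openI => //; exact: closed_openC. Qed.

Section CoveringDimension.
Context (Y : topologicalType).
Implicit Types (S A B : set Y).

(** Finite sum theorem: shrink first along A, then along B, each time only at the
    points of the closed set in question. *)
Lemma cov_dim_lt_setU k A B : closed A -> closed B ->
  cov_dim_lt k A -> cov_dim_lt k B -> cov_dim_lt k (A `|` B).
Proof.
move=> cA cB dA dB m U oU covU.
have [|V [oV VU covV ordV]] := dA m U oU; first by apply: subset_trans covU; left.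
pose U1 i := U i `&` (~` A `|` V i).
have oU1 i : open (U1 i).
  by apply: openI => //; apply: openU => //; exact: closed_openC.
have covU1 : A `|` B `<=` \bigcup_i U1 i.
  move=> y ABy; have [Ay|nAy] := pselect (A y).
    by have [i _ Vy] := covV y Ay; exists i => //; split; [exact: VU|right].
  by have [i _ Uy] := covU y ABy; exists i => //; split => //; left.
have [|W [oW WU covW ordW]] := dB m U1 oU1; first by apply: subset_trans covU1; right.
exists (fun i => U1 i `&` (~` B `|` W i)); split.
- by move=> i; apply: openI => //; apply: openU => //; exact: closed_openC.
- by move=> i y [[]].
- move=> y ABy; have [By|nBy] := pselect (B y).
    by have [i _ Wy] := covW y By; exists i => //; split; [exact: WU|right].
  by have [i _ Uy] := covU1 y ABy; exists i => //; split => //; left.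
- move=> y [Ay|By].
    by apply: leq_trans (ordV y Ay); apply: leq_count => i [[_ []]].
  by apply: leq_trans (ordW y By); apply: leq_count => i [_ []].
Qed.

Lemma cov_dim_lt_set0 k : cov_dim_lt k (set0 : set Y).
Proof.
by move=> m U _ _; exists (fun=> set0); split=> [i|i x []|x []|x []]; exact: open0.
Qed.

Lemma cov_dim_lt_set_type k S :
  cov_dim_lt k [set: set_type S] -> cov_dim_lt k S.
Proof.
move=> dS m U oU covU.
have [i|x _|V [oV VU covV ordV]] := dS m (fun i => set_val @^-1` U i).
- exact: open_set_val.
- by have [i _ Ux] := covU _ (set_valP x); exists i.
have /choice[V' V'P] i : exists V' : set Y, open V' /\ V i = set_val @^-1` V'.
  by have [V' ? ?] := open_set_typeP (oV i); exists V'.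
exists (fun i => U i `&` V' i); split.
- by move=> i; apply: openI => //; case: (V'P i).
- by move=> i y [].
- move=> y Sy; have [i _] := covV (exist _ y (mem_set Sy)) I.
  move=> Vy; exists i => //; split; first exact: (VU _ _ Vy).
  by move: Vy; have [_ ->] := V'P i.
- move=> y Sy; apply: leq_trans (ordV (exist _ y (mem_set Sy)) I).
  by apply: leq_count => i [_ V'y]; have [_ ->] := V'P i.
Qed.

Context (hY : hausdorff_space Y) (cY : compact [set: Y]).

Lemma open_shrinking S m (V : 'I_m -> set Y) : closed S ->
    (forall i, open (V i)) -> S `<=` \bigcup_i V i ->
  exists V' : 'I_m -> set Y, [/\ forall i, open (V' i),
    forall i, closure (V' i) `<=` V i & S `<=` \bigcup_i V' i].
Proof.
move=> cS oV covV.
apply: (compact_ind (P := fun T => exists V' : 'I_m -> set Y,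
  [/\ forall i, open (V' i), forall i, closure (V' i) `<=` V i &
      T `<=` \bigcup_i V' i])).
- exact: subclosed_compact cS cY _.
- by exists (fun=> set0); split => // i; [exact: open0|rewrite closure0].
- by move=> T T' TT [V' [? ? covV']]; exists V'; split => //; exact: subset_trans covV'.
- move=> T T' [V1 [V1o c1 cov1]] [V2 [V2o c2 cov2]].
  exists (fun i => V1 i `|` V2 i); split.
  + by move=> i; exact: openU.
  + by move=> i; rewrite closureU => y [/c1|/c2].
  + move=> y [/cov1|/cov2] [i _ Vy]; exists i => //; [by left|by right].
- move=> x /covV[i _ Vx].
  have Vn : nbhs x (V i) by apply: open_nbhs_nbhs; split.
  have [N Nx NV] := compact_regular hY cY filterT Vn.
  exists N° ; first by apply: open_nbhs_nbhs; split; [exact: open_interior|].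
  exists (fun j => if j == i then N° else set0); split.
  + by move=> j; case: ifP => _; [exact: open_interior|exact: open0].
  + move=> j; case: eqP => [->|_]; last by rewrite closure0.
    exact: subset_trans (closureS (@interior_subset _ _)) NV.
  + by move=> y Ny; exists i => //; rewrite eqxx.
Qed.

(** The order of the shrinking can be controlled everywhere and not only on S:
    shrink once more so that closures have small order on S, and remove the closed
    set of the points where the order of the closures is too large. *)
Lemma cov_dim_lt_global k S m (U : 'I_m -> set Y) : closed S ->
    cov_dim_lt k S -> (forall i, open (U i)) -> S `<=` \bigcup_i U i ->
  exists V : 'I_m -> set Y, [/\ forall i, open (V i), forall i, V i `<=` U i,
    S `<=` \bigcup_i V i & order_le k V [set: Y]].
Proof.
move=> cS dS oU covU; have [V [oV VU covV ordV]] := dS m U oU covU.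
have [V' [oV' V'V covV']] := open_shrinking cS oV covV.
pose E := [set y | (k < \sum_(i < m) `[< closure (V' i) y >])%N].
have cE : closed E.
  rewrite -openC openE => y; rewrite /E /= => /negP; rewrite -leqNgt => yk.
  have : \forall z \near y, forall i, closure (V' i) z -> closure (V' i) y.
    apply: filter_forall => i; have [clVy|nclVy] := pselect (closure (V' i) y).
      exact: nearW.
    have : nbhs y (~` closure (V' i)).
      by apply: open_nbhs_nbhs; split => //; apply/closed_openC/closed_closure.
    exact: filterS.
  apply: filterS => z zy; apply/negP; rewrite -leqNgt.
  by apply: leq_trans yk; apply: leq_count => i; exact: zy.
exists (fun i => V' i `\` E); split.
- by move=> i; apply: open_setD.
- by move=> i y [/subset_closure/V'V/VU].
- move=> y Sy; have [i _ Vy] := covV' y Sy; exists i => //; split => //.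
  apply/negP; rewrite -leqNgt; apply: leq_trans (ordV y Sy).
  by apply: leq_count => j /V'V.
- move=> y _; have [Ey|nEy] := pselect (E y).
    by rewrite big1// => i _; case: asboolP => // -[].
  move: nEy => /negP; rewrite -leqNgt; apply: leq_trans.
  by apply: leq_count => j [/subset_closure].
Qed.

End CoveringDimension.

Section DimensionComparison.

Lemma cov_dim_lt_dim_lt k (Y : topologicalType) :
  cov_dim_lt k [set: Y] -> dim_lt k Y.
Proof.
move=> dY C [finC oC covC].
have [m /card_eqPle[/pcard_surjP[f fC] _]] := finC.
have fsurj V : C V -> exists2 i : 'I_m, f i = V & True.
  by move=> /fC[i im <-]; exists (Ordinal im).
pose U (i : 'I_m) := if `[< C (f i) >] then f i else set0.
have [i|y _|V [oV VU covV ordV]] := dY m U.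
- by rewrite /U; case: asboolP => [/oC//|_]; exact: open0.
- have [W CW Wy] : (\bigcup_(W in C) W) y by rewrite covC.
  by have [i fi _] := fsurj W CW; exists i => //; rewrite /U fi asboolT.
exists (V @` [set i | V i !=set0]); split.
- split.
  + exact/finite_image/finite_finset.
  + by move=> _ [i _ <-].
  + apply/seteqP; split => // y _; have [i _ Vy] := covV y I.
    by exists (V i) => //; exists i => //; exists y.
- move=> _ [i [y Vy] <-]; exists (f i); last first.
    by move=> z /VU; rewrite /U; case: asboolP.
  by move/VU : Vy; rewrite /U; case: asboolP.
- move=> y; pose s := [seq i <- enum 'I_m | `[< V i y >]].
  have sk : (size s <= k)%N.
    apply: leq_trans (ordV y I); rewrite size_filter -sum1_count.
    by rewrite -big_mkcond/= big_enum_cond.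
  have sP i : V i y -> i \in s by move=> Vy; rewrite mem_filter mem_enum andbT asboolT.
  apply: card_le_trans (card_image_le (fun j => nth set0 (map V s) j) `I_k).
  apply: subset_card_le => _ [[i _ <-] Viy].
  have si := sP i Viy; have si' : (index i s < size s)%N by rewrite index_mem.
  exists (index i s) => /=; first exact: leq_trans sk.
  by rewrite (nth_map i)// nth_index.
Qed.

Lemma ind_lt_cov_dim_lt k (Y : topologicalType) : hausdorff_space Y ->
  compact [set: Y] -> ind_lt k Y -> cov_dim_lt k [set: Y].
Proof.
elim: k Y => [|k IH] Y hY cY; first by move=> /= ->; exact: cov_dim_lt_set0.
move=> iY m U oU covU.
(* S is covered by disjoint open sets G i, subordinate to U, and by a closed set F
   of smaller dimension. The closedness of their union makes this property stable
   under unions: a second family is cut down to the complement of the first. *)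
pose P S := exists F (G : 'I_m -> set Y),
  [/\ closed F /\ cov_dim_lt k F, forall i, open (G i) /\ G i `<=` U i,
     forall i j y, G i y -> G j y -> i = j,
     closed (\bigcup_i G i `|` F) & S `<=` \bigcup_i G i `|` F].
have : P [set: Y].
  apply: (compact_ind cY).
  - exists set0, (fun=> set0); split => //.
    + by split; [exact: closed0|exact: cov_dim_lt_set0].
    + by move=> i; split => //; exact: open0.
    + by rewrite setU0 bigcup0//; exact: closed0.
  - move=> S S' SS [F [G [? ? ? ? cov]]]; exists F, G; split => //.
    exact: subset_trans cov.
  - move=> S S' [F [G [[cF dF] oG disj cGF cov]]].
    move=> [F' [G' [[cF' dF'] oG' disj' cGF' cov']]].
    pose H i := G i `|` (G' i `\` (\bigcup_i G i `|` F)).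
    have HE : \bigcup_i H i `|` (F `|` F') =
        (\bigcup_i G i `|` F) `|` (\bigcup_i G' i `|` F').
      apply/seteqP; split => y.
        move=> [[i _ [Gy|[G'y _]]]|[Fy|F'y]].
        + by left; left; exists i.
        + by right; left; exists i.
        + by left; right.
        + by right; right.
      have [GFy _|nGFy] := pselect ((\bigcup_i G i `|` F) y).
        case: GFy => [[i _ Gy]|Fy]; last by right; left.
        by left; exists i => //; left.
      move=> [//|[[i _ Gy]|Fy]]; last by right; right.
      by left; exists i => //; right.
    exists (F `|` F'), H; split.
    + by split; [exact: closedU|exact: cov_dim_lt_setU].
    + move=> i; have [oGi GUi] := oG i; have [oGi' GUi'] := oG' i; split.
        by apply: openU => //; exact: open_setD.
      by move=> y [/GUi|[/GUi']].
    + move=> i j y [Gi|[Gi nG]] [Gj|[Gj nG']].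
      * exact: disj Gi Gj.
      * by case: nG'; left; exists i.
      * by case: nG; left; exists j.
      * exact: disj' Gi Gj.
    + by rewrite HE; exact: closedU.
    + by rewrite HE; exact: setUSS.
  - move=> x _; have [i _ Ux] := covU x I.
    have [] := iY x (~` U i) (open_closedC (oU i)) (fun n => n Ux).
    move=> L [cL [G [G' [[oG xG] [oG' UG'] GG' LE]]]] iL.
    have GU : G `<=` U i.
      move=> y Gy; apply: contrapT => nUy.
      have : (G `&` G') y by split=> //; exact: UG'.
      by rewrite GG'.
    have GL : G `|` L = ~` G'.
      apply/seteqP; split => y.
        move=> [Gy G'y|Ly G'y]; first by rewrite -[False]/(set0 y) -GG'.
        by have : (~` L) y by rewrite LE; right.
      move=> nG'y; have [Ly|nLy] := pselect (L y); first by right.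
      by have : (~` L) y by []; rewrite LE => -[|//]; left.
    have bigGE : \bigcup_j (if j == i then G else set0) = G.
      apply/seteqP; split => [y [j _]|y Gy]; first by case: eqP.
      by exists i => //; rewrite eqxx.
    exists G; first by apply: open_nbhs_nbhs; split => //; exact: xG.
    exists L, (fun j => if j == i then G else set0); split.
    + split => //; apply/cov_dim_lt_set_type/IH => //.
        exact: hausdorff_set_type.
      exact/compact_set_type/(subclosed_compact cL cY).
    + by move=> j; case: eqP => [->|_]; split => //; exact: open0.
    + by move=> j j' y; case: eqP => // -> _; case: eqP.
    + by rewrite bigGE GL; exact: open_closedC.
    + by rewrite bigGE; left.
move=> [F [G [[cF dF] oG disj cGF cov]]].
have [|V [oV VU covV ordV]] := cov_dim_lt_global hY cY cF dF oU.
  by move=> y _; exact: covU.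
exists (fun i => V i `|` G i); split.
- by move=> i; apply: openU => //; case: (oG i).
- by move=> i y [/VU//|Gy]; case: (oG i) => _; exact.
- move=> y _; have [[i _ Gy]|/covV[i _ Vy]] := cov y I.
    by exists i => //; right.
  by exists i => //; left.
- move=> y _; have [[i Gi]|nG] := pselect (exists i, G i y).
    rewrite (bigD1 i)//= -add1n leq_add ?leq_b1//.
    apply: leq_trans (ordV y I); rewrite [leqRHS](bigD1 i)//=.
    rewrite -[leqLHS]add0n leq_add//; apply: leq_sum => j ji.
    case: asboolP => // -[Vy|Gj]; first by rewrite lt0b; apply/asboolP.
    by move/eqP : ji; rewrite (disj _ _ _ Gi Gj).
  apply: leqW; apply: leq_trans (ordV y I); apply: leq_count => i [//|Gi].
  by case: nG; exists i.
Qed.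

Lemma ind_lt_dim_lt k (Y : topologicalType) : hausdorff_space Y ->
  compact [set: Y] -> ind_lt k Y -> dim_lt k Y.
Proof. by move=> hY cY iY; apply/cov_dim_lt_dim_lt/ind_lt_cov_dim_lt. Qed.

Lemma Ind_lt_ind_lt k (Y : topologicalType) : hausdorff_space Y ->
  Ind_lt k Y -> ind_lt k Y.
Proof.
elim: k Y => [//|k IH] Y hY IY x B cB nBx.
have [||L pL iL] := IY [set x] B _ cB.
- exact/accessible_closed_set1/hausdorff_accessible.
- by apply/seteqP; split => // y [/= ->].
- by exists L => //; apply: IH => //; exact: hausdorff_set_type.
Qed.

(** In particular the large inductive dimension is a topological invariant and is
    monotone on closed subsets. *)
Lemma Ind_lt_embedding k (Y Z : topologicalType) (f : Z -> Y) :
    continuous f -> injective f -> (forall A, closed A -> closed (f @` A)) ->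
  Ind_lt k Y -> Ind_lt k Z.
Proof.
elim: k Y Z f => [|k IH] Y Z f cf injf clf /=.
  move=> Y0; apply/seteqP; split => // z _.
  by have : [set: Y] (f z) by []; rewrite Y0.
move=> IY A B cA cB AB.
have [|||L [cL [U [V [[oU AU] [oV BV] UV LE]]]] iL] := IY (f @` A) (f @` B).
- exact: clf.
- exact: clf.
- apply/seteqP; split => // y [[a Aa <-] [b Bb /injf ba]].
  suff : (A `&` B) a by rewrite AB.
  by split => //; rewrite -ba.
have cfL : closed (f @^-1` L) by apply: preimage_closed => // ? _; exact: cf.
exists (f @^-1` L).
  split => //; exists (f @^-1` U), (f @^-1` V); split.
  - split; first by apply: open_comp => // ? _; exact: cf.
    by move=> a Aa; apply: AU; exists a.
  - split; first by apply: open_comp => // ? _; exact: cf.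
    by move=> a Aa; apply: BV; exists a.
  - by rewrite -preimage_setI UV preimage_set0.
  - by rewrite preimage_setC LE preimage_setU.
have gP (z : set_type (f @^-1` L)) : f (set_val z) \in L by apply/mem_set/(set_valP z).
pose g z : set_type L := exist _ (f (set_val z)) (gP z).
apply: (IH (set_type L) _ g) => //.
- apply/continuousP => _ [W oW <-].
  have : open (f @^-1` W) by apply: open_comp => // ? _; exact: cf.
  by move=> /open_set_val.
- by move=> z w /(congr1 val)/injf/val_inj.
- move=> C cC.
  have [W oW CE] := open_set_typeP (closed_openC cC).
  have cfC : closed (f @` (f @^-1` L `&` ~` W)).
    by apply: clf; apply: closedI => //; exact: open_closedC.
  rewrite (_ : g @` C = set_val @^-1` (f @` (f @^-1` L `&` ~` W))).
    exact: closed_set_val.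
  have {}CE : C = set_val @^-1` (~` W) by rewrite -preimage_setC -CE setCK.
  apply/seteqP; split => [_ [z Cz <-]|y [z [Lz nWz] fzy]].
    exists (set_val z) => //; split; first exact: (set_valP z).
    by rewrite CE in Cz.
  by exists (exist _ z (mem_set Lz)); [rewrite CE|exact: val_inj].
Qed.

End DimensionComparison.

(** * The Smirnov compactification of a metric space *)

Section SmirnovCube.
Context (R : realType) (X : metricType R).
Implicit Types (g : @ucb R X) (x y : X) (S T : set X).

Local Notation K := (smirnov_cube X).
Local Notation ev := (@smirnov_eval R X).

(** The extension of g to the cube. *)
Definition smirnov_coord g (z : K) : R := set_val (z g).

Lemma smirnov_coord_eval g x : smirnov_coord g (ev x) = set_val g x.
Proof. by []. Qed.

Lemma smirnov_coord_continuous g : continuous (smirnov_coord g).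
Proof.
move=> z; apply: (@continuous_comp _ _ _ (fun w : K => w g) set_val).
  exact: proj_continuous.
exact: continuous_set_val.
Qed.

Lemma smirnov_coord_inj (z w : K) :
  (forall g, smirnov_coord g z = smirnov_coord g w) -> z = w.
Proof. by move=> zw; apply: functional_extensionality_dep => g; apply/val_inj/zw. Qed.

Lemma near_smirnov_coord g (z : K) (eps : R) : 0 < eps ->
  nbhs z [set w | `|smirnov_coord g z - smirnov_coord g w| < eps].
Proof.
move=> e0; have := @smirnov_coord_continuous g z => /cvgrPdist_lt/(_ _ e0).
exact.
Qed.

Lemma smirnov_cube_hausdorff : hausdorff_space K.
Proof.
by apply: hausdorff_product => g; apply: hausdorff_set_type; exact: Rhausdorff.
Qed.

Lemma smirnov_cube_compact : compact [set: K].
Proof.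
have := @tychonoff _ (fun g : @ucb R X => set_type (smirnov_interval g))
  (fun=> setT) (fun g => compact_set_type (@segment_compact _ _ _)).
by congr compact; apply/seteqP; split.
Qed.

Lemma ucb_dist g (eps : R) : 0 < eps -> exists2 d : R, 0 < d &
  forall x y, mdist x y < d -> `|set_val g x - set_val g y| < eps.
Proof.
move=> e0; have [_ /unif_continuousP/(_ _ e0)[d d0 gd]] := set_valP g.
exists d => // x y xy; apply: (gd (x, y)).
by rewrite ballEmdist.
Qed.

Lemma ucb_lipschitz (f : X -> R) (M : R) : (forall x, `|f x| <= M) ->
  (forall x y, `|f x - f y| <= mdist x y) -> ucb f.
Proof.
move=> fM fL; split.
  by exists M; split => [|r Mr x _]; [exact: num_real|exact: le_trans (ltW Mr)].
apply/unif_continuousP => eps e0; exists eps => // -[x y].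
by rewrite ballEmdist/= => xy; exact: le_lt_trans xy.
Qed.

Lemma closure_smirnov_coord g S (D : set R) (z : K) : closed D ->
  (forall x, S x -> D (set_val g x)) -> closure (ev @` S) z ->
  D (smirnov_coord g z).
Proof.
move=> cD SD; have cgD : closed (smirnov_coord g @^-1` D).
  by apply: preimage_closed => // w _; exact: smirnov_coord_continuous.
have : ev @` S `<=` smirnov_coord g @^-1` D by move=> _ [x Sx <-]; exact: SD.
by move/closureS; rewrite -((closure_id _).1 cgD); exact.
Qed.

(** The distance to S, truncated at eta, is bounded and uniformly continuous. *)
Lemma closure_smirnov_disjoint S T (eta : R) : 0 < eta ->
    (forall x y, S x -> T y -> eta <= mdist x y) ->
  closure (ev @` S) `&` closure (ev @` T) = set0.
Proof.
move=> eta0 ST; have [->|/set0P[s0 Ss0]] := eqVneq S set0.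
  by rewrite image_set0 closure0 set0I.
pose E x := [set Num.min eta (mdist x s) | s in S].
pose f x := inf (E x).
have E0 x : lbound (E x) 0.
  by move=> _ [s _ <-]; rewrite le_min ltW//= mdist_ge0.
have lE x : has_lbound (E x) by exists 0.
have fle x s : S s -> f x <= Num.min eta (mdist x s).
  by move=> Ss; apply: ge_inf => //; exists s.
have f0 x : 0 <= f x.
  by apply: lb_le_inf; [exists (Num.min eta (mdist x s0)), s0|exact: E0].
have fL x y : f x - f y <= mdist x y.
  rewrite lerBlDl -lerBlDr; apply: lb_le_inf.
    by exists (Num.min eta (mdist y s0)), s0.
  move=> _ [s Ss <-]; rewrite lerBlDr (le_trans (fle x s Ss))//.
  have := metric_triangle x y s; rewrite minEle; have := mdist_ge0 x y.
  by rewrite minEle; do 2!case: ifPn; rewrite -?ltNge; lra.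
have uf : ucb f.
  apply: (@ucb_lipschitz _ eta) => [x|x y].
    by rewrite ger0_norm// (le_trans (fle x s0 Ss0))// ge_min lexx.
  rewrite ler_norml fL andbT lerNl opprB (le_trans (fL y x))//.
  by rewrite metric_sym.
pose g : @ucb R X := exist _ f (mem_set uf).
apply/seteqP; split => // z [zS zT].
have : smirnov_coord g z = 0.
  apply: (@closure_smirnov_coord g S [set r | r = 0]) => // x Sx.
  apply/eqP; rewrite eq_le f0 andbT (le_trans (fle x x Sx))// mdistxx.
  by rewrite ge_min lexx orbT.
have : smirnov_coord g z = eta.
  apply: (@closure_smirnov_coord g T [set r | r = eta]) => // x Tx.
  apply/eqP; rewrite eq_le (le_trans (fle x s0 Ss0)) ?ge_min ?lexx//=.
  apply: lb_le_inf; first by exists (Num.min eta (mdist x s0)), s0.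
  by move=> _ [s Ss <-]; rewrite le_min lexx metric_sym ST.
by move=> -> /eqP; rewrite gt_eqF.
Qed.

(** Two sets of points of the cube are far when they have neighbourhoods whose
    traces on X are at positive distance. *)
Definition smirnov_far (A B : set K) := exists (U V : set K) (eta : R),
  [/\ 0 < eta, open U /\ A `<=` U, open V /\ B `<=` V &
    forall x y, U (ev x) -> V (ev y) -> eta <= mdist x y].

Lemma smirnov_far_sym A B : smirnov_far A B -> smirnov_far B A.
Proof.
move=> [U [V [eta [e0 UA VB UV]]]]; exists V, U, eta; split => // x y Vx Uy.
by rewrite metric_sym; exact: UV.
Qed.

Lemma smirnov_farS A B B' : B `<=` B' -> smirnov_far A B' -> smirnov_far A B.
Proof.
move=> BB [U [V [eta [e0 UA [oV VB] UV]]]]; exists U, V, eta; split => //.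
by split => //; exact: subset_trans VB.
Qed.

Lemma smirnov_farU A B B' :
  smirnov_far A B -> smirnov_far A B' -> smirnov_far A (B `|` B').
Proof.
move=> [U [V [eta [e0 [oU UA] [oV VB] UV]]]].
move=> [U' [V' [eta' [e0' [oU' UA'] [oV' VB'] UV']]]].
exists (U `&` U'), (V `|` V'), (Num.min eta eta'); split.
- by rewrite lt_min e0.
- by split; [exact: openI|move=> a Aa; split; [exact: UA|exact: UA']].
- by split; [exact: openU|exact: setUSS].
- move=> x y [Ux Ux'] [Vy|Vy]; rewrite ge_min; apply/orP.
    by left; exact: UV.
  by right; exact: UV'.
Qed.

Lemma smirnov_far0 A : smirnov_far A set0.
Proof.
by exists setT, set0, 1; split => //; split => //; [exact: openT|exact: open0].
Qed.

Lemma smirnov_far_points (a b : K) : a <> b ->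
  exists N, nbhs b N /\ smirnov_far [set a] N.
Proof.
move=> ab; have [g gab] : exists g, smirnov_coord g a <> smirnov_coord g b.
  by apply/existsNP => /smirnov_coord_inj.
pose r : R := `|smirnov_coord g a - smirnov_coord g b| / 3.
have r0 : 0 < r by rewrite divr_gt0// normr_gt0 subr_eq0; apply/eqP.
have [d d0 gd] := ucb_dist g r0.
pose B c := [set w | `|smirnov_coord g c - smirnov_coord g w| < r].
exists (B b)°; split.
  apply: open_nbhs_nbhs; split; first exact: open_interior.
  exact: near_smirnov_coord.
exists (B a)°, (B b)°, d; split => //.
- split; first exact: open_interior.
  by move=> _ ->; exact: near_smirnov_coord.
- by split; first exact: open_interior.
move=> x y /interior_subset Bx /interior_subset By; rewrite leNgt; apply/negP => /gd.
move: Bx By; rewrite /B /= !smirnov_coord_eval.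
move: (set_val g x) (set_val g y) => u v au bv uv.
suff : `|smirnov_coord g a - smirnov_coord g b| < r + r + r by rewrite /r; lra.
rewrite (le_lt_trans (ler_distD u _ _))// -addrA ltrD//.
by rewrite (le_lt_trans (ler_distD v _ _))// ltrD// distrC.
Qed.

Lemma smirnov_far_compact A B : compact A -> compact B -> A `&` B = set0 ->
  smirnov_far A B.
Proof.
move=> cA cB AB; apply: smirnov_far_sym; apply: (compact_ind (P := smirnov_far B)) => //.
- exact: smirnov_far0.
- by move=> S S' SS; exact: smirnov_farS.
- by move=> S S'; exact: smirnov_farU.
move=> a Aa; have : smirnov_far [set a] B.
  apply: (compact_ind (P := smirnov_far [set a])) => //.
  - exact: smirnov_far0.
  - by move=> S S' SS; exact: smirnov_farS.
  - by move=> S S'; exact: smirnov_farU.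
  - move=> b Bb; have [|N [Nb aN]] := @smirnov_far_points a b.
      by move=> ab; rewrite -[False]/(set0 a) -AB; split => //; rewrite ab.
    by exists N.
move=> [U [V [eta [e0 [oU Ua] [oV VB] UV]]]]; exists U.
  by apply: open_nbhs_nbhs; split => //; exact: Ua.
by apply: smirnov_far_sym; exists U, V, eta; split => //; split.
Qed.

End SmirnovCube.

(** * Cubical grids *)

Section Grid.
Context (R : realType).
Implicit Types (h r u v a : R).

(** r is an integral multiple of h. *)
Definition grid h r : bool := r / h \is a Num.int.

(** Index of the half-open interval [m h, (m + 1) h) that contains r. *)
Definition cell h r : int := Num.floor (r / h).

Lemma grid_crossing h a u v : 0 < h -> cell h u != cell h v -> `|u - v| < a ->
  ~~ grid h u -> exists r, [/\ grid h r, `|u - r| < a & 0 <= u -> 0 <= v -> 0 <= r].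
Proof.
move=> h0 cuv uva nu; have hN0 : h != 0 by rewrite gt_eqF.
have gridM (z : int) : grid h (z%:~R * h) by rewrite /grid mulfK// intr_int.
have := floor_le (u / h); have := floor_le (v / h).
rewrite -/(cell h u) -/(cell h v) !ler_pdivlMr// => cv cu.
have [vu|uv|uv] := ltgtP (cell h v) (cell h u); last by rewrite uv eqxx in cuv.
- exists ((cell h u)%:~R * h); split=> //.
  + rewrite (le_lt_trans _ uva)// ger0_norm ?subr_ge0// ler_normr; apply/orP; left.
    rewrite lerD2l lerN2; have : (v / h < (cell h u)%:~R) by rewrite -floor_lt_int.
    by rewrite ltr_pdivrMr// => /ltW.
  + by move=> u0 _; rewrite mulr_ge0 ?ler0z ?floor_ge0 ?divr_ge0// ltW.
- exists ((cell h v)%:~R * h); split=> //.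
  + have : (u / h < (cell h v)%:~R) by rewrite -floor_lt_int.
    rewrite ltr_pdivrMr// => /ltW uc.
    rewrite (le_lt_trans _ uva)// ler0_norm ?subr_le0// ler_normr; apply/orP; right.
    by rewrite !opprB lerD2r.
  + by move=> _ v0; rewrite mulr_ge0 ?ler0z ?floor_ge0 ?divr_ge0// ltW.
Qed.

Lemma grid_same_cell h u v : 0 < h -> grid h u -> grid h v -> `|u - v| < h ->
  cell h u = cell h v.
Proof.
move=> h0 gu gv uv; suff -> : u = v by [].
have : (u - v) / h \is a Num.int by rewrite mulrBl rpredB.
move=> /intrP[z zE]; have : `|z%:~R : R| < 1.
  by rewrite -zE normrM normfV (gtr0_norm h0) ltr_pdivrMr// mul1r.
rewrite -intr_norm ltrz1 -[1]/(0 + 1 :> int) ltzD1 normr_le0 => /eqP z0.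
apply/eqP; rewrite -subr_eq0; move/eqP: zE.
by rewrite z0 mulf_eq0 invr_eq0 (gt_eqF h0) orbF.
Qed.

Lemma dist_same_cell h u v : 0 < h -> cell h u = cell h v -> `|u - v| < h.
Proof.
move=> h0 uv; have := floor_itv (u / h); have := floor_itv (v / h).
rewrite -/(cell h u) -/(cell h v) uv !ler_pdivlMr// !ltr_pdivrMr//.
rewrite intrD mulrDl mul1r; move: (_ * h) => c /andP[cv vc] /andP[cu uc].
by rewrite ltr_norml; apply/andP; split; lra.
Qed.

Lemma grid_divn h r (N : nat) : grid h r -> grid (h / N.+1%:R) r.
Proof.
by move=> gr; rewrite /grid invf_div mulrCA mulrC rpredM// intrE natr_nat.
Qed.

End Grid.

(** Coordinates on a metric space, identifying it up to a bi-Lipschitz map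
    with the space of all points of R^n, or of all those with nonnegative
    coordinates when the flag is set. *)
Record box_coordinates (R : realType) (X : metricType R) (n : nat) (pos : bool)
    (co : X -> 'I_n -> R) : Prop := BoxCoordinates {
  coord_le_mdist : forall x y i, `|co x i - co y i| <= mdist x y;
  mdist_le_coord : forall x y, mdist x y <= \sum_(i < n) `|co x i - co y i|;
  coord_ge0 : forall x i, pos -> 0 <= co x i;
  coord_surj : forall u : 'I_n -> R, (forall i, pos -> 0 <= u i) ->
    exists x, co x = u }.

(** * The remainder of a space with coordinates *)

Section Ends.
Context (R : realType) (X : metricType R) (n : nat) (pos : bool).
Context (co : X -> 'I_n -> R) (coP : box_coordinates pos co).
Implicit Types (x y : X) (S T : set X).

Local Notation K := (smirnov_cube X).
Local Notation ev := (@smirnov_eval R X).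

(** The points added to S in its closure in the compactification. *)
Definition ends S : set K := closure (ev @` S) `\` range ev.

Let mdist_lt_coord x y (d : R) : 0 < d ->
  (forall i, `|co x i - co y i| < d / n.+1%:R) -> mdist x y < d.
Proof.
move=> d0 xy; apply: le_lt_trans (mdist_le_coord coP x y) _.
have n0 : 0 < n.+1%:R :> R by rewrite ltr0n.
apply: (@le_lt_trans _ _ (\sum_(i < n) d / n.+1%:R)).
  by apply: ler_sum => i _; exact: ltW.
rewrite sumr_const card_ord -[X in X < _]mulr_natr mulrAC ltr_pdivrMr//.
by rewrite ltr_pM2l// ltr_nat.
Qed.

(** A limit of points of a bounded set is the point of X whose coordinates are the
    values of the truncated coordinate functions. *)
Lemma closure_bounded_smirnov S (M : R) : (forall x i, S x -> `|co x i| <= M) ->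
  closure (ev @` S) `<=` range ev.
Proof.
move=> SM z clz.
have [S0|/set0P[s0 Ss0]] := eqVneq S set0.
  by move: clz; rewrite S0 image_set0 closure0.
pose f i x := Num.max (- `|M|) (Num.min `|M| (co x i)).
have fE i x : S x -> f i x = co x i.
  move=> /(SM x i) xM; have := le_trans xM (ler_norm M).
  rewrite ler_norml => /andP[? ?]; rewrite /f.
  by rewrite min_r// max_r.
have uf i : ucb (f i).
  apply: (@ucb_lipschitz _ _ _ `|M|) => [x|x y].
    rewrite /f ler_norml; have := normr_ge0 M; move: `|M| => m m0.
    by rewrite le_max lexx ge_max ge_min lexx/=; lra.
  apply: le_trans (coord_le_mdist coP x y i).
  rewrite /f; have := normr_ge0 M; move: `|M| (co x i) (co y i) => m a b m0.
  rewrite ler_norml !maxEle !minEle.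
  have := ler_norm (a - b); have := ler_norm (b - a); rewrite distrC.
  by do ![case: ifPn]; rewrite -?ltNge => *; apply/andP; split; lra.
pose g i : @ucb R X := exist _ (f i) (mem_set (uf i)).
have [|x xE] := coord_surj coP (u := fun i => smirnov_coord (g i) z).
  move=> i p; apply: (@closure_smirnov_coord _ _ (g i) S [set r | 0 <= r]) clz.
    exact: closed_ge.
  by move=> x Sx; rewrite /= -[X in 0 <= X]/(f i x) fE//; exact: (coord_ge0 coP).
exists x => //; apply: smirnov_coord_inj => q; rewrite smirnov_coord_eval.
apply/eqP; rewrite -subr_eq0 -normr_le0 leNgt; apply/negP.
set e := `|_| => e0.
have e20 : 0 < e / 2 by rewrite divr_gt0.
have [d d0 qd] := ucb_dist q e20.
have dn0 : 0 < d / n.+1%:R by rewrite divr_gt0// ltr0n.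
have near_z : nbhs z ([set w | `|smirnov_coord q z - smirnov_coord q w| < e / 2] `&`
    [set w | forall i, `|smirnov_coord (g i) z - smirnov_coord (g i) w| < d / n.+1%:R]).
  apply: filterI; first exact: near_smirnov_coord.
  have := @filter_forall _ _ (fun i => [set w | `|smirnov_coord (g i) z -
    smirnov_coord (g i) w| < d / n.+1%:R]) (nbhs z) _.
  by apply=> i; exact: near_smirnov_coord.
have [_ [[y Sy <-] [zy gy]]] := clz _ near_z.
have : `|set_val q x - set_val q y| < e / 2.
  apply: qd; apply: mdist_lt_coord => // i.
  by rewrite xE -(fE i y Sy); exact: gy i.
move: zy; rewrite /= smirnov_coord_eval; move: (set_val q y) => c zc xc.
have := ler_distD c (set_val q x) (smirnov_coord q z).
rewrite -/e [`|c - _|]distrC; lra.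
Qed.

(** The added points are those at which every truncation of the distance to a base
    point takes its maximal value. *)
Lemma ends_closed S : closed (ends S).
Proof.
have [x0 _] : exists x0 : X, co x0 = fun=> 0 by exact: (coord_surj coP).
pose f (M : R) x := Num.min `|M| (mdist x x0).
have uf M : ucb (f M).
  apply: (@ucb_lipschitz _ _ _ `|M|) => [x|x y].
    by rewrite /f ger0_norm ?ge_min ?lexx// le_min normr_ge0 mdist_ge0.
  rewrite /f; move: (metric_triangle x y x0) (metric_triangle y x x0).
  rewrite (metric_sym y x); move: `|M| (mdist_ge0 x y) => m d0 xy yx.
  by rewrite ler_norml !minEle; do ![case: ifPn]; rewrite -?ltNge => *;
    apply/andP; split; lra.
pose g M : @ucb R X := exist _ (f M) (mem_set (uf M)).
have gE M x : 0 < M -> set_val (g M) x = Num.min M (mdist x x0).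
  by move=> M0; rewrite -[LHS]/(f M x) /f gtr0_norm.
rewrite (_ : ends S = closure (ev @` S) `&`
    \bigcap_(M in [set M | 0 < M]) [set z | smirnov_coord (g M) z = M]).
  apply: closedI; first exact: closed_closure.
  apply: closed_bigI => M _.
  apply: (@preimage_closed _ _ (smirnov_coord (g M)) [set M]).
    by move=> z _; exact: smirnov_coord_continuous.
  exact: closed_eq.
apply/seteqP; split=> z [clz]; last first.
  move=> zM; split => // -[x _ xz].
  have M0 : 0 < mdist x x0 + 1 by rewrite ltr_wpDl// mdist_ge0.
  have := zM _ M0; rewrite /= -xz smirnov_coord_eval gE//.
  by rewrite min_r ?lerDl// => /eqP; rewrite lt_eqF// ltrDl.
move=> zX; split=> // M /= M0; apply: contrapT => zM; apply: zX.
have zM1 : smirnov_coord (g M) z < M.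
  rewrite lt_neqAle; apply/andP; split; first exact/eqP.
  apply: (@closure_smirnov_coord _ _ (g M) S [set r | r <= M]) clz.
    exact: closed_le.
  by move=> x _ /=; rewrite gE// ge_min lexx.
apply: (@closure_bounded_smirnov [set x | mdist x x0 <= M]
    (M + \sum_(i < n) `|co x0 i|)).
  move=> x i /= xM; rewrite -[co x i](subrK (co x0 i)).
  rewrite (le_trans (ler_normD _ _))// lerD//.
    exact: le_trans (coord_le_mdist coP x x0 i) xM.
  by rewrite (bigD1 i)//= lerDl sumr_ge0.
move=> N Nz.
have e0 : 0 < M - smirnov_coord (g M) z by rewrite subr_gt0.
have [_ [[x Sx <-] [zx Nx]]] := clz _ (filterI (near_smirnov_coord (g M) z e0) Nz).
exists (ev x); split => //; exists x => //=; rewrite leNgt; apply/negP => Mx.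
move: zx; rewrite /= smirnov_coord_eval gE// min_l ?(ltW Mx)//.
by rewrite distrC ger0_norm ?ltxx// ltW.
Qed.

Lemma ends_compact S : compact (ends S).
Proof.
exact: (subclosed_compact (@ends_closed S) (@smirnov_cube_compact R X) (fun _ _ => I)).
Qed.

Lemma ends_set0 : ends set0 = set0.
Proof. by rewrite /ends image_set0 closure0 set0D. Qed.

End Ends.

(** * Upper bound: skeletons of grids *)

Section Skeleton.
Context (R : realType) (X : metricType R) (n : nat) (pos : bool).
Context (co : X -> 'I_n -> R) (coP : box_coordinates pos co).
Implicit Types (x y : X) (S T : set X) (h : R) (k : nat).

Local Notation K := (smirnov_cube X).
Local Notation ev := (@smirnov_eval R X).

(** The skeleton of dimension k - 1 of the cubical grid of mesh h: the points with
    at least n + 1 - k coordinates on the grid. It is empty for k = 0. *)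
Definition skeleton k h : set X :=
  [set x | (n < k + #|[pred i | grid h (co x i)]|)%N].

Lemma skeleton0 h : skeleton 0 h = set0.
Proof.
apply/seteqP; split => // x; rewrite /skeleton/= add0n ltnNge.
by rewrite (leq_trans (max_card _)) ?card_ord.
Qed.

Lemma skeletonT h : skeleton n.+1 h = setT.
Proof. by apply/seteqP; split => // x _; rewrite /skeleton/= ltnS leq_addr. Qed.

Lemma skeleton_divn k h (N : nat) : skeleton k h `<=` skeleton k (h / N.+1%:R).
Proof.
move=> x; rewrite /skeleton/= => /leq_trans; apply; rewrite leq_add2l.
by apply: subset_leq_card; apply/fintype.subsetP => i; rewrite !inE; exact: grid_divn.
Qed.

Let skeleton_replace k h u i (r : R) : skeleton k.+1 h u -> ~~ grid h (co u i) ->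
    grid h r -> (pos -> 0 <= r) ->
  exists2 q, skeleton k h q & mdist u q <= `|co u i - r|.
Proof.
move=> uk nu gr r0.
have [|q qE] := coord_surj coP (u := fun j => if j == i then r else co u j).
  by move=> j p; case: eqP => // _; [exact: r0|exact: (coord_ge0 coP)].
exists q.
  move: uk; rewrite /skeleton /= addSnnS => /leq_trans; apply; rewrite leq_add2l.
  rewrite (cardD1 i [pred j | grid h (co q j)]) inE qE eqxx gr add1n ltnS.
  apply: subset_leq_card; apply/fintype.subsetP => j; rewrite !inE => gj.
  by case: eqP gj => [->|//]; rewrite (negbTE nu).
apply: le_trans (mdist_le_coord coP u q) _.
rewrite (bigD1 i)//= qE eqxx big1 ?addr0// => j /negbTE ->.
by rewrite subrr normr0.
Qed.

(** Two nearby points of a skeleton lying in different half-open cells are close to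
    the skeleton of the next lower dimension: one coordinate of the first point can
    be moved slightly onto the grid, namely one that crosses a grid value or one in
    which only the second point lies on the grid. *)
Lemma skeleton_crossing k h (a : R) u v : 0 < h -> a <= h ->
    skeleton k.+1 h u -> skeleton k.+1 h v -> mdist u v < a ->
    (exists i, cell h (co u i) != cell h (co v i)) ->
  exists2 q, skeleton k h q & mdist u q < a.
Proof.
move=> h0 ah uk vk uv [i cuv].
have uvi j : `|co u j - co v j| < a by exact: le_lt_trans (coord_le_mdist coP u v j) uv.
have [gu|ngu] := boolP (grid h (co u i)); last first.
  have [r [gr ur r0]] := grid_crossing h0 cuv (uvi i) ngu.
  have [|q qk uq] := skeleton_replace uk ngu gr.
    by move=> p; apply: r0; exact: (coord_ge0 coP).
  by exists q => //; exact: le_lt_trans ur.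
have ngv : ~~ grid h (co v i).
  apply: contraNN cuv => gv; apply/eqP/grid_same_cell => //.
  exact: lt_le_trans (uvi i) ah.
have [uk'|nuk] := boolP (n < k + #|[pred i | grid h (co u i)]|)%N.
  exists u => //; rewrite mdistxx.
  exact: le_lt_trans (mdist_ge0 u v) uv.
have [j /andP[gvj nguj]] : exists j, grid h (co v j) && ~~ grid h (co u j).
  apply/existsP; apply: contraNT nuk; rewrite negb_exists => /forallP guv.
  move: vk; rewrite /skeleton /= addSnnS => /leq_trans; apply; rewrite leq_add2l.
  apply: proper_card; apply/fintype.properP; split.
    by apply/fintype.subsetP => j; have := guv j; rewrite !inE negb_and negbK; case: grid.
  by exists i; rewrite inE.
have [|q qk uq] := skeleton_replace uk nguj gvj.
  by move=> p; exact: (coord_ge0 coP).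
by exists q => //; exact: le_lt_trans uq (uvi j).
Qed.

Lemma Ind_lt_ends_skeleton k h : 0 < h ->
  Ind_lt k (set_type (ends (skeleton k h))).
Proof.
elim: k h => [h _|k IH h h0].
  rewrite /= skeleton0 ends_set0; apply/seteqP; split => // z _.
  exact: (set_valP z).
set P := skeleton k.+1 h; set T := ends P.
have cT : compact T by exact: ends_compact coP _.
move=> A B cA cB AB.
have val_compact (C : set (set_type T)) : closed C -> compact (set_val @` C).
  move=> cC; apply: continuous_compact.
    by apply: continuous_subspaceT; exact: continuous_set_val.
  exact: (subclosed_compact cC (compact_set_type cT) (fun _ _ => I)).
have [|||OA [OB [eta [eta0 [oOA AO] [oOB BO] far]]]] :=
    @smirnov_far_compact _ _ (set_val @` A) (set_val @` B) _ _.
- exact: val_compact.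
- exact: val_compact.
- apply/seteqP; split => // z [[a Aa <-] [b Bb /val_inj ba]].
  suff : (A `&` B) a by rewrite AB.
  by split => //; rewrite -ba.
(* The subdivision is so fine that the cells have diameter less than eta. *)
pose N := Num.truncn (n%:R * h / eta); pose g := h / N.+1%:R.
have g0 : 0 < g by rewrite divr_gt0// ltr0n.
have ng : n%:R * g < eta.
  rewrite /g mulrA ltr_pdivrMr ?ltr0n// [eta * _]mulrC -ltr_pdivrMr//.
  exact: truncnS_gt.
have PP : P `<=` skeleton k.+1 g by exact: skeleton_divn.
pose same x y := forall i, cell g (co x i) = cell g (co y i).
pose U := [set x | P x /\ exists2 y, P y & OA (ev y) /\ same x y].
pose V := P `\` U.
have PE : P = U `|` V.
  apply/seteqP; split => x; last by move=> [[]|[]].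
  by move=> Px; have [|] := pselect (U x); [left|right].
have clT z : T z -> closure (ev @` U) z \/ closure (ev @` V) z.
  by move=> [+ _]; rewrite PE image_setU closureU.
have Aclv a : A a -> ~ closure (ev @` V) (set_val a).
  move=> Aa clV.
  have OAa : nbhs (set_val a) OA.
    by apply: open_nbhs_nbhs; split => //; apply: AO; exists a.
  have [_ [[x [Px nUx] <-] Ox]] := clV OA OAa.
  by apply: nUx; split => //; exists x.
have Bclu b : B b -> ~ closure (ev @` U) (set_val b).
  move=> Bb clU.
  have OBb : nbhs (set_val b) OB.
    by apply: open_nbhs_nbhs; split => //; apply: BO; exists b.
  have [_ [[x [Px [y Py [Oy xy]]] <-] Ox]] := clU OB OBb.
  have := far _ _ Oy Ox; apply/negP; rewrite -ltNge; apply: le_lt_trans ng.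
  apply: le_trans (mdist_le_coord coP y x) _.
  rewrite mulr_natl -[X in _ *+ X](card_ord n) -sumr_const; apply: ler_sum => i _.
  by apply/ltW/dist_same_cell.
pose L : set (set_type T) :=
  set_val @^-1` (closure (ev @` U) `&` closure (ev @` V)).
have cL : closed L by apply: closed_set_val; apply: closedI; exact: closed_closure.
exists L.
  split => //; exists (set_val @^-1` (~` closure (ev @` V))),
    (set_val @^-1` (~` closure (ev @` U))); split.
  - by split => //; exact/open_set_val/closed_openC/closed_closure.
  - by split => //; exact/open_set_val/closed_openC/closed_closure.
  - by apply/seteqP; split => // z [/= nV nU]; have [] := clT _ (set_valP z).
  - by rewrite /L !preimage_setC setUC -preimage_setU -setCI.
(* Otherwise U and V would be at positive distance near z. *)
have LQ z : L z -> ends (skeleton k g) (set_val z).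
  move=> [clU clV]; split; last by have [] := set_valP z.
  apply: contrapT => nQ.
  have [||Oz [OQ [d [d0 [oOz Ozz] [oOQ QO] dfar]]]] :=
    @smirnov_far_compact _ _ [set set_val z] (closure (ev @` skeleton k g))
      (@compact_set1 _ _) _.
  - apply: (subclosed_compact _ (@smirnov_cube_compact R X)) => //.
    exact: closed_closure.
  - by apply/seteqP; split => // w [/= -> ].
  have trace (S : set X) : closure (ev @` S) (set_val z) ->
      closure (ev @` (S `&` [set x | Oz (ev x)])) (set_val z).
    move=> clS W Wz.
    have Ozn : nbhs (set_val z) Oz by apply: open_nbhs_nbhs; split => //; exact: Ozz.
    have [_ [[x Sx <-] [Wx Ox]]] := clS _ (filterI Wz Ozn).
    by exists (ev x); split => //; exists x.
  have a0 : 0 < Num.min g d by rewrite lt_min g0.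
  suff /seteqP[+ _] : closure (ev @` (U `&` [set x | Oz (ev x)])) `&`
      closure (ev @` (V `&` [set x | Oz (ev x)])) = set0.
    by apply; split; exact: trace.
  apply: (closure_smirnov_disjoint a0).
  move=> u v [[Pu [y Py [Oy uy]]] Ou] [[Pv nUv] Ov]; rewrite leNgt; apply/negP => uv.
  have [||q Qq uq] := skeleton_crossing g0 _ (PP _ Pu) (PP _ Pv) uv.
  - by rewrite ge_min lexx.
  - apply: contrapT => /forallNP cuv; apply: nUv; split => //; exists y => //; split => // i.
    by rewrite -(uy i); apply/esym/eqP; apply: contrapT => /negP /cuv.
  have := dfar _ _ Ou (QO _ (subset_closure (ex_intro2 _ _ q Qq erefl))).
  by apply/negP; rewrite -ltNge (lt_le_trans uq)// ge_min lexx orbT.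
pose f (z : set_type L) : set_type (ends (skeleton k g)) :=
  exist _ (set_val (set_val z)) (mem_set (LQ _ (set_valP z))).
have cf : continuous f.
  apply/continuousP => _ [W oW <-].
  have : open (set_val @^-1` W : set (set_type T)) by exact: open_set_val.
  by move=> /open_set_val.
apply: (@Ind_lt_embedding _ _ _ f cf _ _ (IH g g0)).
- by move=> z w /(congr1 val) zw; apply/val_inj/val_inj.
- move=> C cC; apply: compact_closed.
    exact/hausdorff_set_type/smirnov_cube_hausdorff.
  apply: continuous_compact; first exact: continuous_subspaceT.
  apply: (subclosed_compact cC _ (fun _ _ => I)).
  apply: compact_set_type.
  exact: (subclosed_compact cL (compact_set_type cT) (fun _ _ => I)).
Qed.

Lemma Ind_lt_smirnov_remainder : Ind_lt n.+1 (smirnov_remainder X).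
Proof. by have := @Ind_lt_ends_skeleton n.+1 1 ltr01; rewrite skeletonT. Qed.

End Skeleton.

(** * Labellings of a grid *)

Lemma mulmx_eq0_det (R : idomainType) n (u : 'rV[R]_n) (M : 'M[R]_n) :
  \det M != 0 -> u *m M = 0 -> u = 0.
Proof.
move=> dM uM; have : \det M *: u = 0.
  by rewrite -mul_mx_scalar -mul_mx_adj mulmxA uM mul0mx.
move=> /rowP dU; apply/rowP => i; have := dU i; rewrite !mxE => /eqP.
by rewrite mulf_eq0 (negbTE dM) => /eqP.
Qed.

Section GridLabels.
Context (n N : nat) (D : Type) (W : {ffun 'I_n -> nat} -> D).
Context (q : D -> 'I_n -> bool).
Local Notation M := N.+1.
Context (q0 : forall (t : {ffun 'I_n -> nat}) i, t i = 0%N -> q (W t) i = false).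
Context (qM : forall (t : {ffun 'I_n -> nat}) i, t i = M -> q (W t) i = true).

(* The torus of integer points modulo 2 M, folded onto the grid {0, .., M}^n. *)
Local Notation T := 'rV['I_(N.*2.+2)]_n.

Let e (i : 'I_n) : T := delta_mx ord0 i.
Let v (x : T) (i : 'I_n) : nat := x ord0 i.
Let fold (a : nat) : nat := if (a <= M)%N then a else (M.*2 - a)%N.
Let F (x : T) : {ffun 'I_n -> nat} := [ffun i => fold (v x i)].
Let Q (x : T) (i : 'I_n) : int := (q (W (F x)) i)%:R.

(* The function equal to q on the first half of the i-th circle and to 2 - q on the
   second half grows by 2 around the circle. Its difference, multiplied by M, is
   the sum of the constant form and of the exact form of b i. *)
Let b (i : 'I_n) (x : T) : int :=
  M%:R * (if (v x i <= M)%N then Q x i else 2 - Q x i) - (v x i)%:R.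

Let sgn (a : nat) : int := if (a < M)%N then 1 else -1.

Let v_lt x i : (v x i < M.*2)%N.
Proof. exact: ltn_ord. Qed.

Let v_step x k i : v (x + e k) i =
  if i == k then (if (v x i).+1 == M.*2 then 0%N else (v x i).+1) else v x i.
Proof.
rewrite /v !mxE eqxx/=; have := ltn_ord (x ord0 i).
case: eqP => [_|_] xi; last by rewrite addn0 modn_small.
rewrite (_ : (true%:R : 'I_(N.*2.+2)) = 1%N :> nat)// addn1.
case: eqP => [->|xM]; first by rewrite doubleS modnn.
by rewrite modn_small// ltn_neqAle xi andbT; apply/eqP.
Qed.

Let Q0 x i : v x i = 0%N -> Q x i = 0.
Proof. by move=> xi; rewrite /Q q0// ffunE xi. Qed.

Let QM x i : v x i = M -> Q x i = 1.
Proof. by move=> xi; rewrite /Q qM// ffunE xi /fold leqnn. Qed.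

Let Q01 x i : Q x i = 0 \/ Q x i = 1.
Proof. by rewrite /Q; case: (q _ _); [right|left]. Qed.

Let b_step x k i : (i == k)%:R + exact_form e (b i) x k =
  M%:R * sgn (v x i) * (Q (x + e k) i - Q x i).
Proof.
rewrite /exact_form /b v_step; have := v_lt x i.
have := @Q0 x i; have := @QM x i.
have := @Q0 (x + e k) i; have := @QM (x + e k) i; rewrite v_step.
have := Q01 x i; have := Q01 (x + e k) i.
move: (Q x i) (Q (x + e k) i) (v x i) => c c' a.
rewrite /sgn; case: (i == k) => /=.
  case: eqP => [aM _ cc QM' Q0' QMx Q0x _|aM cc' cc QM' Q0' QMx Q0x aM2].
    rewrite (Q0' erefl) leq0n; have [aM'|aM'] := leqP a M.
      have {}aM' : a = M by move: aM' aM; rewrite doubleS; lia.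
      by rewrite (QMx aM') aM' ltnn; lia.
    rewrite ifF; last by apply/negbTE; rewrite -leqNgt ltnW.
    by case: cc => ->; move: aM; rewrite doubleS; lia.
  have [aM'|aM'|aM'] := ltngtP a M.
  - by case: cc' cc => -> [] ->; lia.
  - by case: cc' cc => -> [] ->; lia.
  - by rewrite (QMx aM') aM'; case: cc' => ->; lia.
move=> cc' cc QM' Q0' QMx Q0x aM2.
have [aM'|aM'|aM'] := ltngtP a M.
- by case: cc' cc => -> [] ->; lia.
- by case: cc' cc => -> [] ->; lia.
- by rewrite (QMx aM') (QM' aM'); lia.
Qed.

Section Path.
Context (x : T) (s : 'S_n).

Let pt (t : nat) : T := x + \sum_(l < n | (l < t)%N) e (s l).

Let ptS (j : 'I_n) : pt j.+1 = pt j + e (s j).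
Proof.
rewrite /pt (bigD1 j)//= -addrA [X in _ = _ + X]addrC; congr (_ + (_ + _)).
by apply: eq_bigl => l; rewrite -val_eqE/=; lia.
Qed.

Let v_pt t i : v (pt t) i = v (x + if (s^-1%g i < t)%N then e i else 0) i.
Proof.
rewrite /pt /v [in LHS]mxE [in RHS]mxE summxE; congr (nat_of_ord (_ + _)).
have ei l : e (s l) ord0 i = (i == s l)%:R by rewrite mxE eqxx.
case: ifP => ti.
  rewrite (bigD1 (s^-1%g i))//= permKV big1 ?addr0// => l /andP[_ li].
  rewrite ei; case: eqP => // il; case/eqP: li.
  by rewrite il permK.
rewrite mxE big1// => l lt; rewrite ei; case: eqP => // il.
by move: ti; rewrite il permK lt.
Qed.

(* The sign of the half of the i-th circle can be taken at the origin of the path: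
   it only changes at 0 and M, where Q x i is determined. *)
Let theta_pt (j i : 'I_n) : (i == s j)%:R + exact_form e (b i) (pt j) (s j) =
  M%:R * sgn (v x i) * (Q (pt j.+1) i - Q (pt j) i).
Proof.
rewrite b_step -ptS; have := v_pt j i; case: ifP => [ij|_ ->]; last by rewrite addr0.
rewrite v_step eqxx => vj.
have vj1 : v (pt j.+1) i = v (pt j) i.
  rewrite ptS v_step ifF//; apply/negP => /eqP isj.
  by move: ij; rewrite isj permK ltnn.
move: vj vj1; have := @Q0 (pt j) i; have := @QM (pt j) i.
have := @Q0 (pt j.+1) i; have := @QM (pt j.+1) i => QM' Q0' QM1 Q01' vj vj1.
have [vM|vM] := eqVneq (v (pt j) i) M; first by rewrite QM1// QM' ?vj1// subrr !mulr0.
have [v0|v0] := eqVneq (v (pt j) i) 0%N; first by rewrite Q01'// Q0' ?vj1// subrr !mulr0.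
congr (_ * _ * _); rewrite /sgn; move: vM v0; rewrite vj.
by case: (_ =P M.*2) => // ? /eqP ? _; congr (if _ then _ else _); lia.
Qed.

Let F_pt t i : (F (pt t) i <= (F x i).+1)%N && (F x i <= (F (pt t) i).+1)%N.
Proof.
rewrite !ffunE v_pt; case: ifP => _; last by rewrite addr0; lia.
rewrite v_step eqxx /fold; have := v_lt x i; move: (v x i) => a.
by case: (_ =P M.*2) => aM aM2 /=; case: (leqP a M) => ?; case: (ltnP a M) => ?; lia.
Qed.

(** Equal labels at two vertices give a linear relation between the edges of the
    path joining them. *)
Lemma path_labels_injective :
    \det (\matrix_(j, i) ((i == s j)%:R +
      exact_form e (b i) (x + path_offset e s j) (s j))) != 0 ->
  injective (fun j : 'I_n.+1 => W (F (pt j))).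
Proof.
move=> dM; suff lt_inj (j1 j2 : 'I_n.+1) : (j1 < j2)%N ->
    W (F (pt j1)) <> W (F (pt j2)).
  move=> j1 j2 /= W12; apply/val_inj; have [lt12|lt21|//] := ltngtP j1 j2.
    by case: (lt_inj _ _ lt12).
  by case: (lt_inj _ _ lt21).
move=> j12 W12; pose u : 'rV[int]_n := \row_j ((j1 <= j < j2)%N)%:R.
have j1n : (j1 < n)%N by apply: leq_trans j12 _; rewrite -ltnS.
suff /rowP/(_ (Ordinal j1n)) : u = 0 by rewrite !mxE /= leqnn j12.
apply: (mulmx_eq0_det dM); apply/rowP => i; rewrite !mxE.
pose G (t : nat) := M%:R * sgn (v x i) * Q (pt t) i.
transitivity (\sum_(j1 <= j < j2) (G j.+1 - G j)).
  rewrite (big_nat_widen _ _ n) ?big_geq_mkord -1?ltnS//.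
  rewrite [RHS]big_mkcond/=; apply: eq_bigr => j _; rewrite !mxE andbC.
  case: ifP => _; last by rewrite mul0r.
  by rewrite mul1r /G -mulrBr; exact: theta_pt.
rewrite telescope_sumr; last exact: ltnW.
by rewrite /G /Q W12 subrr.
Qed.

Lemma path_labels :
    \det (\matrix_(j, i) ((i == s j)%:R +
      exact_form e (b i) (x + path_offset e s j) (s j))) != 0 ->
  exists (t : {ffun 'I_n -> nat}) (y : 'I_n.+1 -> {ffun 'I_n -> nat}),
    (forall j i, (y j i <= (t i).+1)%N && (t i <= (y j i).+1)%N) /\
    injective (W \o y).
Proof.
move=> dM; exists (F x), (fun j => F (pt j)).
by split => [j i|]; [exact: F_pt|exact: path_labels_injective].
Qed.

End Path.

(** If the labels separate opposite faces of the grid {0, .., M}^n, then some n + 1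
    points within distance 1, in each coordinate, of a common point have distinct
    labels. *)
Lemma exists_distinct_labels :
  exists (t : {ffun 'I_n -> nat}) (y : 'I_n.+1 -> {ffun 'I_n -> nat}),
    (forall j i, (y j i <= (t i).+1)%N && (t i <= (y j i).+1)%N) /\
    injective (W \o y).
Proof.
have [x [s dM]] := exists_det_neq0 e b.
exact: path_labels dM.
Qed.
End GridLabels.

(** * Lower bound: limits of cubes going to infinity *)

Section LowerBound.
Context (R : realType) (X : metricType R) (n : nat) (pos : bool).
Context (co : X -> 'I_n -> R) (coP : box_coordinates pos co) (n_gt0 : (0 < n)%N).

Local Notation K := (smirnov_cube X).
Local Notation ev := (@smirnov_eval R X).
Local Notation Y := (set_type (ends setT : set K)).
Local Notation grid_point := {ffun 'I_n -> nat}.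

(** Any two neighbourhoods of z and w contain points of X at distance less than
    eta. *)
Definition smirnov_close (eta : R) (z w : K) := forall U V : set K,
  nbhs z U -> nbhs w V -> exists x y, [/\ U (ev x), V (ev y) & mdist x y < eta].

Lemma smirnov_close_le (eta eta' : R) z w : eta <= eta' ->
  smirnov_close eta z w -> smirnov_close eta' z w.
Proof.
move=> ee zw U V zU wV; have [x [y [Ux Vy xy]]] := zw U V zU wV.
by exists x, y; split => //; exact: lt_le_trans ee.
Qed.

Lemma remainder_compact : compact [set: Y].
Proof. by apply: compact_set_type; exact: (ends_compact coP). Qed.

Lemma remainder_hausdorff : hausdorff_space Y.
Proof. by apply: hausdorff_set_type; exact: smirnov_cube_hausdorff. Qed.

(** Lebesgue number of a finite open cover of the remainder. *)
Lemma remainder_lebesgue_number (D : set (set Y)) : finite_open_cover D ->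
  exists2 eta : R, 0 < eta & forall y : Y, exists2 W, D W &
    forall y' : Y, smirnov_close eta (set_val y) (set_val y') -> W y'.
Proof.
move=> [_ oD covD].
suff [eta eta0 H] : exists2 eta : R, 0 < eta & forall y : Y, [set: Y] y ->
    exists2 W, D W &
    forall y' : Y, smirnov_close eta (set_val y) (set_val y') -> W y'.
  by exists eta => // y; exact: H.
apply: (compact_ind (P := fun S : set Y => exists2 eta : R, 0 < eta &
    forall y : Y, S y -> exists2 W, D W &
    forall y' : Y, smirnov_close eta (set_val y) (set_val y') -> W y')).
- exact: remainder_compact.
- by exists 1.
- by move=> S S' SS [eta eta0 H]; exists eta => // y /SS /H.
- move=> S S' [eta eta0 H] [eta' eta0' H']; exists (Num.min eta eta').
    by rewrite lt_min eta0.
  move=> y [/H|/H'] [W DW HW]; exists W => // y' yy'; apply: HW;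
    by apply: smirnov_close_le yy'; rewrite ge_min lexx ?orbT.
- move=> y0 _; have [W DW Wy] : (\bigcup_(W in D) W) y0 by rewrite covD.
  have cW : compact (set_val @` (~` W) : set K).
    apply: continuous_compact.
      by apply: continuous_subspaceT; exact: continuous_set_val.
    apply: (subclosed_compact _ remainder_compact (fun _ _ => I)).
    exact/open_closedC/oD.
  have [|U [V [eta [eta0 [oU Uy] [oV VW] UV]]]] :=
      @smirnov_far_compact _ _ [set set_val y0] _ (@compact_set1 _ _) cW.
    by apply/seteqP; split => // z [/= -> [y nWy /val_inj yy0]]; apply: nWy; rewrite yy0.
  exists (set_val @^-1` U).
    apply: open_nbhs_nbhs; split; first exact: open_set_val.
    exact: Uy.
  exists eta => // y Uy'; exists W => // y' yy'; apply: contrapT => nWy'.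
  have [||x [x' [Ux Vx' xx']]] := yy' U V.
  - by apply: open_nbhs_nbhs; split.
  - by apply: open_nbhs_nbhs; split => //; apply: VW; exists y'.
  by have := UV _ _ Ux Vx'; rewrite leNgt xx'.
Qed.

Section Family.
Context (M : nat).

Let coords (k : nat) (t : grid_point) (i : 'I_n) : R :=
  (2 * k)%:R + (t i)%:R / M.+1%:R.

Let coords_ge0 k t i : 0 <= coords k t i.
Proof. by rewrite addr_ge0// divr_ge0. Qed.

(** The k-th copy of the grid of mesh 1 / M.+1 is translated by (2k, .., 2k). A
    cluster point as k goes to infinity is taken for all grid points at once, in a
    power of the compact space of the compactification, so that the same k can
    serve for two grid points. *)
Lemma exists_limit_grid : exists (p : nat -> grid_point -> X)
    (Phi : grid_point -> K), (forall k t, co (p k t) = coords k t) /\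
  forall t t' (U V : set K) k0, nbhs (Phi t) U -> nbhs (Phi t') V ->
    exists k, [/\ (k0 <= k)%N, U (ev (p k t)) & V (ev (p k t'))].
Proof.
have /choice[p pE] (kt : nat * grid_point) : exists x, co x = coords kt.1 kt.2.
  by apply: (coord_surj coP) => i _; exact: coords_ge0.
pose seqp (k : nat) : prod_topology (fun _ : grid_point => K) :=
  fun t => ev (p (k, t)).
have cP : compact [set: prod_topology (fun _ : grid_point => K)].
  have := @tychonoff grid_point (fun _ => K) (fun=> setT)
    (fun _ => @smirnov_cube_compact R X).
  by congr compact; apply/seteqP; split.
have [Phi [_ clPhi]] := cP (seqp @ \oo) _ filterT.
exists (fun k t => p (k, t)), Phi; split => [k t|t t' U V k0 tU tV].
  exact: pE (k, t).
have near_k : (seqp @ \oo) (seqp @` [set k | (k0 <= k)%N]).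
  by exists k0 => // k k0k; exists k.
have near_coord s (W : set K) : nbhs (Phi s) W ->
    nbhs (Phi : prod_topology (fun _ : grid_point => K)) [set f | W (f s)].
  exact: (@proj_continuous grid_point (fun _ => K) s Phi).
have [_ [[k k0k <-] [Ut Vt]]] := clPhi _ _ near_k
  (@filterI _ _ (nbhs_filter _) _ _ (near_coord t U tU) (near_coord t' V tV)).
by exists k.
Qed.

End Family.

(* The points whose i-th coordinate is an even, or odd, natural number. *)
Let face (i : 'I_n) (odd : bool) : set X :=
  [set x | exists k : nat, co x i = (2 * k + odd)%:R].

Let faces_disjoint i :
  closure (ev @` face i false) `&` closure (ev @` face i true) = set0.
Proof.
apply: (closure_smirnov_disjoint ltr01) => x y [k xk] [l yl].
apply: le_trans (coord_le_mdist coP x y i); rewrite xk yl addn0 addn1 -natr1.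
have [kl|lk] := leqP k l.
  rewrite ler0_norm; last by rewrite subr_le0 ler_wpDr// ler_nat leq_mul2l.
  by rewrite opprB lerBrDr addrC lerD2r ler_nat leq_mul2l.
rewrite ger0_norm; last by rewrite subr_ge0 natr1 ler_nat; lia.
by rewrite lerBrDl !natr1 ler_nat; lia.
Qed.

Lemma not_dim_lt_smirnov_remainder : ~ dim_lt n Y.
Proof.
move=> dimY.
(* C s consists of the points that avoid, for each i, the limits of the face chosen
   by s. *)
pose C (s : {ffun 'I_n -> bool}) : set Y :=
  [set y | forall i, ~ closure (ev @` face i (s i)) (set_val y)].
have [|D [coverD refD ordD]] := dimY (range C).
  split.
  - exact/finite_image/finite_finset.
  - move=> _ [s _ <-].
    rewrite openE => y Cy.
    have := @filter_forall _ _ (fun i =>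
      set_val @^-1` (~` closure (ev @` face i (s i)))) (nbhs y) _.
    apply=> i; apply: open_nbhs_nbhs; split; last exact: Cy.
    exact/open_set_val/closed_openC/closed_closure.
  - apply/seteqP; split => // y _.
    exists (C [ffun i => `[< closure (ev @` face i false) (set_val y) >]]).
      by exists [ffun i => `[< closure (ev @` face i false) (set_val y) >]].
    move=> i; rewrite ffunE; case: asboolP => // yf yt.
    by rewrite -[False]/((set0 : set K) (set_val y)) -(faces_disjoint i).
have [eta eta0 leb] := remainder_lebesgue_number coverD.
pose M := Num.truncn (n%:R / eta).
have M0 : 0 < M.+1%:R :> R by rewrite ltr0n.
have nM : n%:R / M.+1%:R < eta.
  by rewrite ltr_pdivrMr// mulrC -ltr_pdivrMr//; exact: truncnS_gt.
have [p [Phi [pE PhiP]]] := exists_limit_grid M.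
have Phi_closure t (S : set X) : (exists k0, forall k, (k0 <= k)%N -> S (p k t)) ->
    closure (ev @` S) (Phi t).
  move=> [k0 St] U tU; have [k [k0k Uk _]] := PhiP t t U setT k0 tU filterT.
  by exists (ev (p k t)); split => //; exists (p k t) => //; exact: St.
have Phi_ends t : ends setT (Phi t).
  split; first by apply: Phi_closure; exists 0%N.
  move=> [x _ xt]; pose i0 := Ordinal n_gt0.
  pose k0 := (Num.truncn (co x i0)).+1.
  pose S := [set p k t | k in [set k | (k0 <= k)%N]].
  have : closure (ev @` [set x]) `&` closure (ev @` S) = set0.
    apply: (closure_smirnov_disjoint ltr01) => _ _ /= -> [k k0k <-].
    apply: le_trans (coord_le_mdist coP x (p k t) i0).
    have xk : co x i0 < k0%:R by exact: truncnS_gt.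
    have k2 : k0%:R + 1 <= (2 * k)%:R :> R.
      by rewrite natr1 ler_nat; move: k0k; rewrite /= /k0; lia.
    have tM : 0 <= (t i0)%:R / M.+1%:R :> R by rewrite divr_ge0.
    have dist_ge1 (a b c d : R) : a < b -> b + 1 <= c -> 0 <= d -> 1 <= `|c + d - a|.
      by move=> ? ? ?; rewrite ler_normr; apply/orP; left; lra.
    by rewrite distrC pE; exact: dist_ge1 xk k2 tM.
  move=> /seteqP[/(_ (Phi t))+ _]; apply; split.
    by rewrite -xt; apply: subset_closure; exists x.
  by apply: Phi_closure; exists k0 => k k0k; exists k.
pose phi t : Y := exist _ (Phi t) (mem_set (Phi_ends t)).
have phi_close (t t' : grid_point) :
    (forall i, (t i <= (t' i).+1)%N && (t' i <= (t i).+1)%N) ->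
    smirnov_close eta (set_val (phi t)) (set_val (phi t')).
  move=> tt U V tU tV; have [k [_ Uk Vk]] := PhiP t t' U V 0%N tU tV.
  exists (p k t), (p k t'); split => //; apply: le_lt_trans nM.
  apply: le_trans (mdist_le_coord coP _ _) _.
  rewrite mulr_natl -[X in _ *+ X](card_ord n) -sumr_const; apply: ler_sum => i _.
  rewrite !pE/= opprD addrACA subrr add0r -mulrBl normrM normfV (gtr0_norm M0).
  rewrite ler_piMl ?invr_ge0 ?ler0n//; have /andP[tt1 tt2] := tt i.
  by rewrite ler_norml lerBrDl lerBlDr natr1 ler_nat tt2 lerBlDl natr1 ler_nat.
have /choice[W WP] t : exists W, D W /\
    forall y', smirnov_close eta (set_val (phi t)) (set_val y') -> W y'.
  by have [W DW HW] := leb (phi t); exists W.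
have Wphi t : W t (phi t).
  by have [_] := WP t; apply; apply: phi_close => i; rewrite leqnSn.
(* q V i tells whether V avoids the limits of the even face in direction i. *)
pose q (V : set Y) i :=
  `[< forall y, V y -> ~ closure (ev @` face i false) (set_val y) >].
have [|t i tM|x [y [yx Wy]]] := @exists_distinct_labels n M (set Y) W q.
- move=> t i t0; apply/negbTE/asboolPn => /(_ _ (Wphi t)); apply.
  apply: Phi_closure; exists 0%N => k _; exists k.
  by rewrite pE t0 mul0r addn0 addr0.
- have [Wt _] := WP t; have [_ [s _ <-] sub] := refD _ Wt.
  have si : s i = false.
    apply/negbTE/negP => si; have := sub _ (Wphi t) i; rewrite si; apply.
    apply: Phi_closure; exists 0%N => k _; exists k.
    by rewrite pE tM divff ?gt_eqF// natrD.
  by apply/asboolP => y /sub/(_ i); rewrite si.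
have : ([set: 'I_n.+1] #<= `I_n)%card.
  apply: card_le_trans (ordD (phi x)).
  rewrite -(card_le_eql (inj_card_eq (in2W Wy))).
  apply: subset_card_le => _ [j _ <-]; have [DW HW] := WP (y j).
  by split => //; apply/HW/phi_close => i; exact: yx.
by rewrite -(card_le_eql card_II) card_le_II ltnn.
Qed.

End LowerBound.

(** * Coordinates on the two spaces *)

Section Coordinates.
Context (R : realType).

Lemma smirnov_remainder_dimensions (X : metricType R) (n : nat) (pos : bool)
    (co : X -> 'I_n -> R) : box_coordinates pos co -> (0 < n)%N ->
  [/\ ind_eq (smirnov_remainder X) n, Ind_eq (smirnov_remainder X) n &
      dim_eq (smirnov_remainder X) n].
Proof.
move=> coP n0.
have hY : hausdorff_space (smirnov_remainder X) :=
  @remainder_hausdorff R X.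
have cY : compact [set: smirnov_remainder X] := remainder_compact coP.
have IY := Ind_lt_smirnov_remainder coP.
have ndY : ~ dim_lt n (smirnov_remainder X) := not_dim_lt_smirnov_remainder coP n0.
have niY : ~ ind_lt n (smirnov_remainder X) by move=> /(ind_lt_dim_lt hY cY).
have iY := Ind_lt_ind_lt hY IY.
split; split => //; last exact: ind_lt_dim_lt.
by move=> /(Ind_lt_ind_lt hY).
Qed.

Lemma euclid_coordinates n : box_coordinates false (@euclid_coord R n).
Proof.
split => // [x y i|x y|u _].
- rewrite -sqrtr_sqr; apply: ler_wsqrtr.
  by rewrite (bigD1 i)//= lerDl sumr_ge0// => j _; exact: sqr_ge0.
- rewrite -[leRHS]ger0_norm ?sumr_ge0// -sqrtr_sqr; apply: ler_wsqrtr.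
  suff [] :
      0 <= \sum_(i < n) `|euclid_coord x i - euclid_coord y i| /\
      \sum_(i < n) (euclid_coord x i - euclid_coord y i) ^+ 2 <=
      (\sum_(i < n) `|euclid_coord x i - euclid_coord y i|) ^+ 2 by [].
  apply: (big_ind2 (fun a b : R => 0 <= b /\ a <= b ^+ 2)) =>
    [|a b c d [b0 ab] [d0 cd]|i _].
  + by rewrite expr0n.
  + by split; [exact: addr_ge0|nra].
  + by rewrite normr_ge0 real_normK ?num_real.
- by exists (\row_i u i : 'rV[R]_n); apply/funext => i; rewrite /euclid_coord mxE.
Qed.

Lemma orthant_coordinates n : box_coordinates true
  (fun x : set_type (orthant R n) => euclid_coord (set_val x)).
Proof.
have [le ge _ surj] := euclid_coordinates n; split.
- by move=> x y i; exact: le.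
- by move=> x y; exact: ge.
- by move=> x i _; exact: (set_valP x).
- move=> u u0; have [//|x xu] := surj u.
  have xO : orthant R n x by move=> i; rewrite xu; exact: u0.
  by exists (exist _ x (mem_set xO)).
Qed.

End Coordinates.

Theorem corollary2p4 (R : realType) (n : nat) (n_gt0 : (0 < n)%N) :
  [/\ ind_eq (smirnov_remainder (euclid R n)) n,
      Ind_eq (smirnov_remainder (euclid R n)) n &
      dim_eq (smirnov_remainder (euclid R n)) n] /\
  [/\ ind_eq (smirnov_remainder (set_type (orthant R n))) n,
      Ind_eq (smirnov_remainder (set_type (orthant R n))) n &
      dim_eq (smirnov_remainder (set_type (orthant R n))) n].
Proof.
split.
  exact: smirnov_remainder_dimensions (euclid_coordinates R n) n_gt0.
exact: smirnov_remainder_dimensions (orthant_coordinates R n) n_gt0.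
Qed.
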